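(* Let $p\ge3$ be odd, write $p=2q+1$, and let $\ell$ be an integer with $p-1\le\ell\le\min\{n-(p-1),\frac{n}{4(p-1)},\frac{n}{8\log n}\}$. Let $\mathbf{Y}\in(\mathbb{R}^n)^{\otimes p}$ have i.i.d. Rademacher (uniform $\pm1$) entries, and let $\mathbf{M}$ be the $n^\ell\times n^\ell$ matrix defined below. Then for every tensor $\mathbf{Y}$ one has $\|\mathbf{Y}\|_\pm\le n^{1/2}+n^{\ell/2-q}\|\mathbf{M}\|^{1/2}$, and with probability at least $1-n^{-\ell}$ over $\mathbf{Y}$, \[n^{1/2}+n^{\ell/2-q}\|\mathbf{M}\|^{1/2}\le n^{1/2}+8p^p\ell^{1/2-p/4}n^{p/4}(\log n)^{1/4};\] that is, $\|\mathbf{M}\|$ certifies $\|\mathbf{Y}\|_\pm\le n^{1/2}+8p^p\ell^{1/2-p/4}n^{p/4}(\log n)^{1/4}$.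
   Context: Rademacher injective norm: $\|\mathbf{Y}\|_\pm=\max_{x\in\{\pm1\}^n/\sqrt n}|\langle\mathbf{Y},x^{\otimes p}\rangle|$. Index the $p$ coordinates of $\mathbf{Y}$ as $\mathbf{Y}_{ace}$ with $a,c\in[n]^q$, $e\in[n]$. For $a,b,c,d\in[n]^q$ let $\mathbf{T}_{abcd}=\sum_{e\in[n]}\mathbf{Y}_{ace}\mathbf{Y}_{bde}$ and $\tilde{\mathbf{T}}_{abcd}=\mathbf{T}_{abcd}\cdot\mathbf{1}\{ac\ne bd\}$, where $ac$ denotes concatenation of tuples. For tuples $S,T\in[n]^\ell$ and $a,b,c,d\in[n]^q$, write $S\overset{ab,cd}{\longleftrightarrow}T$ if there are distinct indices $i_1,\ldots,i_{2q}\in[\ell]$ such that either (i) $S_{i_j}=(ab)_j$ and $T_{i_j}=(cd)_j$ for all $j\in[2q]$, the values appearing in $a,b,c,d$ do not appear anywhere else in $S$ or $T$, and $S_i=T_i$ for all $i\notin\{i_1,\ldots,i_{2q}\}$; or (ii) the same holds with $ab$ and $cd$ interchanged. Let $N_{ab,cd}$ be the number of pairs $(S,T)$ with $S\overset{ab,cd}{\longleftrightarrow}T$. Then $\mathbf{M}_{S,T}=\sum_{a,b,c,d\in[n]^q}\tilde{\mathbf{T}}_{abcd}N_{ab,cd}^{-1}\mathbf{1}\{S\overset{ab,cd}{\longleftrightarrow}T\}$ for $S,T\in[n]^\ell$. $\|\mathbf{M}\|$ is the operator norm.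
   Formalization: The deterministic bound ''for every tensor Y'' is stated for every tensor with ±1 entries (every realization of the Rademacher tensor); for arbitrary real tensors it fails, e.g. a single very large entry gives M = 0. *)

(* Defs.v *)
From HB Require Import structures.
From mathcomp Require Import all_boot all_order all_algebra.
From mathcomp Require Import all_classical all_reals all_analysis.
Set Implicit Arguments. Unset Strict Implicit. Unset Printing Implicit Defensive.
Import Order.TTheory GRing.Theory Num.Theory.
Local Open Scope ring_scope.
Local Open Scope classical_set_scope.

(* Throughout, p = 2q+1 is encoded as (q+q).+1, coordinates range over 'I_n. *)
Notation idx n q := ((q + q).+1.-tuple 'I_n).
Notation ttuple n l := (l.-tuple 'I_n).

Section Defs.
Variable R : realType.

Definition sgnb (b : bool) : R := if b then 1 else -1.

Definition Ysign n q (s : {ffun idx n q -> bool}) : idx n q -> R :=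
  fun i => sgnb (s i).

Definition inj_norm n q (Y : idx n q -> R) : R :=
  \big[Num.max/0]_(x : {ffun 'I_n -> bool})
     `| \sum_(i : idx n q) Y i * \prod_(j < (q + q).+1)
            (sgnb (x (tnth i j)) / Num.sqrt (n%:R)) |.

Definition ace n q (a c : q.-tuple 'I_n) (e : 'I_n) : idx n q :=
  rcons_tuple (cat_tuple a c) e.

Definition Tt n q (Y : idx n q -> R) (a b c d : q.-tuple 'I_n) : R :=
  (\sum_(e : 'I_n) Y (ace a c e) * Y (ace b d e)) *
  (if (cat_tuple a c) != (cat_tuple b d) then 1 else 0).

Definition link1 n q l (S T : ttuple n l) (u v : (q + q).-tuple 'I_n) : bool :=
  [exists f : {ffun 'I_(q + q) -> 'I_l},
    [&& injectiveb f,
        [forall j, (tnth S (f j) == tnth u j) && (tnth T (f j) == tnth v j)]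
      & [forall i, (i \notin codom f) ==>
           [&& tnth S i \notin (u : seq 'I_n) ++ v,
               tnth T i \notin (u : seq 'I_n) ++ v
             & tnth S i == tnth T i]]]].

Definition linked n q l (S T : ttuple n l) (a b c d : q.-tuple 'I_n) : bool :=
  link1 S T (cat_tuple a b) (cat_tuple c d) || link1 S T (cat_tuple c d) (cat_tuple a b).

Definition Ncount n q l (a b c d : q.-tuple 'I_n) : nat :=
  #|[set ST : ttuple n l * ttuple n l | linked ST.1 ST.2 a b c d]|.

Definition Mmat n q l (Y : idx n q -> R) (S T : ttuple n l) : R :=
  \sum_(a : q.-tuple 'I_n) \sum_(b : q.-tuple 'I_n)
  \sum_(c : q.-tuple 'I_n) \sum_(d : q.-tuple 'I_n)
    Tt Y a b c d * ((Ncount l a b c d)%:R)^-1 *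
    (if linked S T a b c d then 1 else 0).

Definition opnorm (I : finType) (M : I -> I -> R) : R :=
  sup [set Num.sqrt (\sum_i (\sum_j M i j * x j) ^+ 2) |
         x in [set x : I -> R | \sum_i x i ^+ 2 = 1]].

Definition rad_prob n q (P : (idx n q -> R) -> bool) : R :=
  (#|[set s : {ffun idx n q -> bool} | P (Ysign s)]|%:R) /
  (2 ^ #|{: idx n q}|)%:R.

End Defs.

(* Main.v *)
(* The bound on the injective norm is Cauchy-Schwarz over the last index: the resulting sum of
   squares is [n] plus the quadratic form of [M] at [x^{(x) l}] up to the factor [n^(l - 2q)].

   The tail bound is a trace moment computation. Expanding in Walsh characters of the signs, the
   [K]-th moment counts closed walks [S_0, ..., S_K] in which every variable [Y_ace] is used an
   even number of times. Along a walk, keep track of the set [O] of variables used an odd number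
   of times so far, and let [u_e] be the number of those whose last index is [e]. The weight
   [Phi O = z^|O| * prod_e u_e!!] is a supersolution of the one-step recursion, hence dominates the
   number of completions of the walk: opening two variables multiplies [Phi] by [z^2 (u_e + 2)],
   closing two divides it by [z^2 u_e], and a pair to be closed is chosen in [u_e (u_e - 1)] ways,
   so that each step costs [O(sqrt(n K))] times the square root of the degree when
   [z^2 ~ sqrt(K / n)]. Taking [K ~ 2 l log n <= n / 2] and Markov's inequality gives the theorem. *)
Require Import Defs.
From HB Require Import structures.
From mathcomp Require Import all_boot all_order all_algebra.
From mathcomp Require Import all_classical all_reals all_analysis.
From mathcomp Require Import ring lra zify.
From mathcomp Require Import finset.
Import Order.TTheory GRing.Theory Num.Theory.
Local Open Scope ring_scope.
Set Implicit Arguments. Unset Strict Implicit. Unset Printing Implicit Defensive.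

(** * Finite real matrices: operator norm, powers and traces *)

Section FiniteOperators.
Context {R : realType} {I : finType}.
Implicit Types (M : I -> I -> R) (x y : I -> R).

(** Lagrange's identity: twice the defect is the sum of the squares of the [2 x 2] minors of the
    pair [x], [y]. *)
Lemma cauchy_schwarz x y :
  (\sum_i x i * y i) ^+ 2 <= (\sum_i x i ^+ 2) * (\sum_i y i ^+ 2).
Proof.
have h : 0 <= \sum_i \sum_j (x i * y j - x j * y i) ^+ 2.
  by apply: sumr_ge0 => i _; apply: sumr_ge0 => j _; exact: sqr_ge0.
have e : \sum_i \sum_j (x i * y j - x j * y i) ^+ 2 =
    2 * ((\sum_i x i ^+ 2) * (\sum_i y i ^+ 2) - (\sum_i x i * y i) ^+ 2).
  transitivity (\sum_i \sum_j (x i ^+ 2 * y j ^+ 2 + y i ^+ 2 * x j ^+ 2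
      - 2 * ((x i * y i) * (x j * y j)))).
    by apply: eq_bigr => i _; apply: eq_bigr => j _; ring.
  under eq_bigr => i _ do rewrite sumrB big_split /= -!mulr_sumr.
  by rewrite sumrB big_split /= -!mulr_suml -mulr_sumr -mulr_suml; ring.
by move: h; rewrite e pmulr_rge0 // subr_ge0.
Qed.

Definition app M x : I -> R := fun i => \sum_j M i j * x j.

Fixpoint mpow M t (i j : I) : R :=
  if t is t'.+1 then \sum_k M i k * mpow M t' k j else (i == j)%:R.

Lemma mpowD M s t i j :
  mpow M (s + t) i j = \sum_k mpow M s i k * mpow M t k j.
Proof.
elim: s i => [|s IH] i /=.
  rewrite (bigD1 i) //= eqxx mul1r big1 ?addr0 // => k /negPf ki.
  by rewrite eq_sym ki mul0r.
under [RHS]eq_bigr => k _ do rewrite mulr_suml.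
rewrite exchange_big /=; apply: eq_bigr => k _.
by rewrite IH mulr_sumr; apply: eq_bigr => m _; rewrite mulrA.
Qed.

Lemma mpow1 M i j : mpow M 1 i j = M i j.
Proof.
rewrite /= (bigD1 j) //= eqxx mulr1 big1 ?addr0 // => k /negPf kj.
by rewrite kj mulr0.
Qed.

Lemma mpow_sym M t : (forall i j, M i j = M j i) ->
  forall i j, mpow M t i j = mpow M t j i.
Proof.
move=> Msym; elim: t => [|t IH] i j; first by rewrite /= eq_sym.
rewrite -[in RHS]addn1 mpowD /=; apply: eq_bigr => k _.
by rewrite -/(mpow M 1 k i) mpow1 Msym IH mulrC.
Qed.

Lemma iter_appE M t x i : iter t (app M) x i = \sum_j mpow M t i j * x j.
Proof.
elim: t i => [|t IH] i /=.
  rewrite (bigD1 i) //= eqxx mul1r big1 ?addr0 // => k /negPf ki.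
  by rewrite eq_sym ki mul0r.
transitivity (\sum_k \sum_j M i k * (mpow M t k j * x j)).
  by apply: eq_bigr => k _; rewrite IH mulr_sumr.
rewrite exchange_big /=; apply: eq_bigr => j _.
by rewrite mulr_suml; apply: eq_bigr => k _; rewrite mulrA.
Qed.

Lemma app_sq_le M x : \sum_i (app M x i) ^+ 2 <=
  (\sum_i \sum_j M i j ^+ 2) * \sum_i x i ^+ 2.
Proof. by rewrite mulr_suml ler_sum // => i _; exact: cauchy_schwarz. Qed.

Lemma opnorm_ub M x : \sum_i x i ^+ 2 = 1 ->
  Num.sqrt (\sum_i (app M x i) ^+ 2) <= opnorm M.
Proof.
move=> x1; rewrite /opnorm; apply: ub_le_sup; last by exists x.
(* A supremum bounds its set only when the set is bounded above; here the Frobenius norm is an upper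
   bound. *)
exists (Num.sqrt (\sum_i \sum_j M i j ^+ 2)) => _ [y /= y1 <-].
rewrite ler_sqrt ?(le_trans (app_sq_le M y)) ?y1 ?mulr1 //.
by apply: sumr_ge0 => i _; apply: sumr_ge0 => j _; exact: sqr_ge0.
Qed.

Lemma quadratic_form_le_opnorm M x : \sum_i x i ^+ 2 = 1 ->
  \sum_i \sum_j M i j * (x i * x j) <= opnorm M.
Proof.
move=> x1; apply: le_trans (opnorm_ub M x1).
have -> : \sum_i \sum_j M i j * (x i * x j) = \sum_i x i * app M x i.
  apply: eq_bigr => i _; rewrite mulr_sumr; apply: eq_bigr => j _.
  by rewrite mulrCA.
apply: le_trans (ler_norm _) _; rewrite -sqrtr_sqr ler_sqrt //; last first.
  by apply: sumr_ge0 => i _; exact: sqr_ge0.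
by apply: le_trans (cauchy_schwarz _ _) _; rewrite x1 mul1r.
Qed.

(* Log-convexity of [j |-> |M^j x|^2] bounds [|Mx|^(2k)] by [|M^k x|^2], which is at most
   the squared Frobenius norm of [M^k]. *)
Lemma app_sq_le_trace M x k : (forall i j, M i j = M j i) -> \sum_i x i ^+ 2 = 1 ->
  (\sum_i (app M x i) ^+ 2) ^+ k <= \sum_i mpow M (k + k) i i.
Proof.
move=> Msym x1.
pose a j := \sum_i (iter j (app M) x i) ^+ 2.
have a_ge0 j : 0 <= a j by apply: sumr_ge0 => i _; exact: sqr_ge0.
have self_adj y w : \sum_i app M y i * w i = \sum_i y i * app M w i.
  under eq_bigr => i _ do rewrite /app mulr_suml.
  rewrite exchange_big /=; apply: eq_bigr => j _.
  rewrite /app mulr_sumr; apply: eq_bigr => i _.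
  by rewrite Msym mulrAC mulrC.
have a_cvx j : a j.+1 ^+ 2 <= a j * a j.+2.
  have -> : a j.+1 = \sum_i iter j (app M) x i * iter j.+2 (app M) x i.
    by rewrite -self_adj; apply: eq_bigr => i _; rewrite expr2.
  exact: cauchy_schwarz.
(* By log-convexity the ratios [a j.+1 / a j] do not decrease, and the first one is [a 1] because
   [a 0 = 1]. If [a j = 0], convexity forces [a j.+1 = 0], so no division by zero occurs. *)
have a_super j : a 1%N * a j <= a j.+1.
  elim: j => [|j IH]; first by rewrite {2}/a /= x1 mulr1.
  have [aj0|aj0] := eqVneq (a j) 0.
    have : a j.+1 ^+ 2 <= 0 by rewrite (le_trans (a_cvx j)) // aj0 mul0r.
    by rewrite exprn_even_le0 //= => /eqP ->; rewrite mulr0.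
  have aj_gt0 : 0 < a j by rewrite lt0r aj0 a_ge0.
  rewrite -(ler_pM2l aj_gt0) (le_trans _ (a_cvx j)) // mulrA expr2.
  by rewrite ler_wpM2r // mulrC.
have le_ak : a 1%N ^+ k <= a k.
  elim: k => [|k IH]; first by rewrite /a /= x1 expr0.
  by rewrite exprS (le_trans _ (a_super k)) // ler_wpM2l.
apply: (le_trans le_ak).
have -> : a k = \sum_i (app (mpow M k) x i) ^+ 2.
  by apply: eq_bigr => i _; rewrite iter_appE.
apply: le_trans (app_sq_le _ _) _; rewrite x1 mulr1 ler_sum // => i _.
by rewrite mpowD ler_sum // => j _; rewrite expr2 [in leRHS](mpow_sym _ Msym j i).
Qed.

Lemma opnorm_le_of_trace M k tau : (0 < #|I|)%N -> (0 < k)%N -> 0 <= tau ->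
  (forall i j, M i j = M j i) ->
  \sum_i mpow M (k + k) i i <= tau ^+ (k + k) -> opnorm M <= tau.
Proof.
move=> /card_gt0P[i0 _] k0 tau0 Msym tr_le; apply: ge_sup.
  (* A basis vector shows that the set under the supremum is nonempty. *)
  eexists; exists (fun i => (i == i0)%:R) => //=.
  rewrite (bigD1 i0) //= eqxx expr1n big1 ?addr0 // => i /negPf ->.
  by rewrite expr0n.
move=> _ [x /= x1 <-]; rewrite -(ger0_norm tau0) -sqrtr_sqr ler_sqrt ?sqr_ge0 //.
rewrite -(@ler_pXn2r _ k) ?nnegrE ?sqr_ge0 //; last first.
  by apply: sumr_ge0 => i _; exact: sqr_ge0.
apply: le_trans (app_sq_le_trace k Msym x1) (le_trans tr_le _).
by rewrite -exprM mul2n addnn.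
Qed.

End FiniteOperators.

(** * Walsh characters on the sign cube *)

Section Walsh.
Context {R : realType} {V : finType}.
Implicit Types (O : {set V}) (v : V) (s : {ffun V -> bool}).

Definition chi O s : R := \prod_(v in O) sgnb R (s v).

(** The symmetric difference of [O] with the singleton of [v]: since signs square to one,
    multiplying a character by one sign toggles one variable. *)
Definition flip O v : {set V} := if v \in O then O :\ v else v |: O.

Lemma sgnb_sq b : sgnb R b * sgnb R b = 1.
Proof. by case: b; rewrite /sgnb ?mulrNN mulr1. Qed.

Lemma chi_flip O v s : chi (flip O v) s = chi O s * sgnb R (s v).
Proof.
rewrite /flip /chi; case: ifPn => vO; last by rewrite big_setU1 //= mulrC.
by rewrite (big_setD1 v vO) /= mulrC mulrA sgnb_sq mul1r.
Qed.

(** The sum factors over the coordinates, and each coordinate in [O] contributes [1 + (-1) = 0]. *)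
Lemma sum_chi O : \sum_s chi O s = (O == set0)%:R * 2 ^+ #|V|.
Proof.
have -> : \sum_s chi O s =
    \sum_(s : {ffun V -> bool}) \prod_v (if v \in O then sgnb R (s v) else 1).
  by apply: eq_bigr => s _; rewrite /chi big_mkcond.
rewrite -(bigA_distr_bigA (fun v b => if v \in O then sgnb R b else 1)) /=.
have [->|/set0Pn[v vO]] := eqVneq O set0.
  rewrite mul1r -prodr_const; apply: eq_bigr => v _.
  by rewrite big_bool !inE.
by rewrite mul0r (bigD1 v) //= big_bool vO /sgnb /= subrr mul0r.
Qed.

Lemma card_flip O v : (#|O| <= (#|flip O v|).+1)%N.
Proof.
rewrite /flip; case: ifPn => vO; first by rewrite (cardsD1 v O) vO.
by rewrite cardsU1 vO; lia.
Qed.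

End Walsh.

(** * The double-factorial potential and its one-step inequality *)

Fixpoint dfact (u : nat) : nat := if u is u'.+2 then u * dfact u' else 1.

Lemma dfact_gt0 u : (0 < dfact u)%N.
Proof.
suff : (0 < dfact u)%N /\ (0 < dfact u.+1)%N by case.
by elim: u => [//|u [IH1 IH2]]; split; rewrite //= muln_gt0.
Qed.

Lemma natr_card {R : realType} {V : finType} (O : {set V}) :
  \sum_o (o \in O)%:R = #|O|%:R :> R.
Proof.
rewrite -sum1_card natr_sum [RHS]big_mkcond /=.
by apply: eq_bigr => o _; case: (o \in O).
Qed.

Section Potential.
Context {R : realType} {V E : finType}.
Variables (el : V -> E) (z : R).
Hypothesis z_gt0 : 0 < z.
Implicit Types (O : {set V}) (v w : V).

Definition cls O (e : E) : nat := #|[set v in O | el v == e]|.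

(** The weight [Phi] for an abstract class map [el], later taken to be the last index of a variable.
    The double factorial makes two new variables in a class of size [u] cost exactly [u + 2]. *)
Definition potential O : R := z ^+ #|O| * \prod_e (dfact (cls O e))%:R.

Lemma potential_gt0 O : 0 < potential O.
Proof.
rewrite mulr_gt0 ?exprn_gt0 //; apply: prodr_gt0 => e _.
by rewrite ltr0n dfact_gt0.
Qed.

Lemma potential0 : potential set0 = 1.
Proof.
rewrite /potential cards0 expr0 mul1r big1 // => e _.
by rewrite /cls (_ : [set _ in _ | _] = set0) ?cards0 //; apply/setP => v; rewrite !inE.
Qed.

Lemma clsU1 O v e : v \notin O -> cls (v |: O) e = ((el v == e) + cls O e)%N.
Proof.
move=> vO; rewrite /cls; have [ve|/negPf ve] := boolP (el v == e).
  rewrite (_ : [set _ in _ | _] = v |: [set w in O | el w == e]).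
    by rewrite cardsU1 !inE (negPf vO).
  apply/setP => w; rewrite !inE; case: eqP => //= ->.
  by rewrite ve.
congr #|pred_of_set _|; apply/setP => w; rewrite !inE.
by case: eqP => //= ->; rewrite ve (negPf vO).
Qed.

Lemma sum_cls O : (\sum_e cls O e)%N = #|O|.
Proof.
rewrite -sum1_card (partition_big el predT) //=; apply: eq_bigr => e _.
by rewrite /cls -sum1_card; apply: eq_bigl => v; rewrite inE.
Qed.

Lemma potential_add2 O v w : v \notin O -> w \notin v |: O -> el v = el w ->
  potential (w |: (v |: O)) = z ^+ 2 * (cls O (el v)).+2%:R * potential O.
Proof.
move=> vO wO vw; rewrite /potential !cardsU1 wO vO !add1n !exprS.
have -> : \prod_e (dfact (cls (w |: (v |: O)) e))%:R =
   (cls O (el v)).+2%:R * \prod_e (dfact (cls O e))%:R :> R.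
  rewrite (bigD1 (el v)) //= [X in _ = _ * X](bigD1 (el v)) //=.
  rewrite !clsU1 // -vw eqxx !add1n /= natrM mulrA; congr (_ * _).
  by apply: eq_bigr => e /negPf ne; rewrite !clsU1 // -vw eq_sym ne.
by rewrite !expr0 /=; ring.
Qed.

Lemma potential_swap O v w : v \in O -> w \notin O -> el v = el w ->
  potential (w |: (O :\ v)) = potential O.
Proof.
move=> vO wO vw.
have vD : v \notin O :\ v by rewrite !inE eqxx.
have wD : w \notin O :\ v by rewrite !inE negb_and wO orbT.
rewrite -[X in _ = potential X](setD1K vO) /potential !cardsU1 vD wD; congr (_ * _).
by apply: eq_bigr => e _; rewrite !clsU1 // vw.
Qed.

Lemma potential_remove2 O v w : v \in O -> w \in O -> v != w -> el v = el w ->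
  potential (O :\ v :\ w) = potential O * ((cls O (el v))%:R^-1 / z ^+ 2).
Proof.
move=> vO wO nvw vw.
have wOv : w \in O :\ v by rewrite !inE eq_sym nvw.
have w' : w \notin O :\ v :\ w by rewrite !inE eqxx.
have v' : v \notin w |: (O :\ v :\ w) by rewrite setD1K // !inE eqxx.
have OE : v |: (w |: (O :\ v :\ w)) = O by rewrite setD1K // setD1K.
have := potential_add2 w' v' (esym vw); rewrite OE => ->.
have -> : cls O (el v) = (cls (O :\ v :\ w) (el w)).+2.
  by rewrite -{1}OE !clsU1 // vw eqxx.
have z2 : z ^+ 2 != 0 by rewrite expf_neq0 // gt_eqF.
set p := potential _; set c := (_.+2)%:R.
have c0 : c != 0 by rewrite pnatr_eq0.
by rewrite -invfM [c * _]mulrC mulrAC mulfV ?mul1r // mulf_neq0.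
Qed.

(** Four cases: both variables open, one opens while the other closes ([Phi] is unchanged), or both
    close. The bound adds all the cases with indicators, which makes it linear and ready for
    summation over labels. *)
Lemma potential_flip2 O v w : v != w -> el v = el w ->
  potential (flip (flip O v) w) <= potential O *
   (z ^+ 2 * (cls O (el v)).+2%:R + (v \in O)%:R + (w \in O)%:R +
    (v \in O)%:R * (w \in O)%:R * (cls O (el v))%:R^-1 / z ^+ 2).
Proof.
move=> nvw vw; have P0 := potential_gt0 O.
have z2 : 0 < z ^+ 2 by rewrite exprn_gt0.
set a := z ^+ 2 * _.
have a0 : 0 <= a by rewrite mulr_ge0 // ltW.
have wv : (w == v) = false by apply/negbTE; rewrite eq_sym.
case: (boolP (v \in O)) => vO; case: (boolP (w \in O)) => wO.
- rewrite /flip vO !inE wO wv /= potential_remove2 // ler_wpM2l ?(ltW P0) // !mul1r.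
  by rewrite lerDr; lra.
- rewrite /flip vO !inE (negPf wO) andbF potential_swap // ler_peMr ?(ltW P0) //.
  by rewrite (_ : false%:R = 0) // (_ : true%:R = 1) // mulr0 !mul0r; lra.
- rewrite /flip (negPf vO) !inE wO orbT.
  have -> : (v |: O) :\ w = v |: (O :\ w).
    apply/setP => x; rewrite !inE; case: (eqVneq x v) => //= ->.
    by rewrite eq_sym wv.
  by rewrite potential_swap // ler_peMr ?(ltW P0) // (_ : false%:R = 0) // (_ : true%:R = 1) // !mul0r; lra.
- rewrite /flip (negPf vO) !inE wv (negPf wO) /=.
  have wO' : w \notin v |: O by rewrite !inE negb_or wv.
  by rewrite potential_add2 // !mul0r !addr0 mulrC.
Qed.

Context {X : finType}.
Variables (P : pred X) (v1 v2 : X -> V) (A B C : R).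
Hypotheses (el12 : forall x, P x -> el (v1 x) = el (v2 x))
  (v12 : forall x, P x -> v1 x != v2 x)
  (leA : forall e, \sum_(x | P x && (el (v1 x) == e)) 1 <= A)
  (leB1 : forall o, \sum_(x | P x && (v1 x == o)) 1 <= B)
  (leB2 : forall o, \sum_(x | P x && (v2 x == o)) 1 <= B)
  (leC : forall o o', \sum_(x | P x && (v1 x == o) && (v2 x == o')) 1 <= C).

(** The labels are grouped by class for openings ([A]), by one variable for swaps ([B]) and by both
    variables for closings ([C]). Openings see the sum of [u_e + 2] over all classes, that is
    [#|O| + 2 #|E|]. For closings, the at most [u_e ^ 2] ordered pairs of a class carry weight
    [1 / u_e], which leaves [u_e] per class and [#|O|] in total. *)
Lemma potential_sum_le O : 0 <= C ->
  \sum_(x | P x) potential (flip (flip O (v1 x)) (v2 x)) <= potential O *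
    (A * (z ^+ 2 * (#|O| + #|E|.*2)%:R) + B * #|O|%:R *+ 2 + C * #|O|%:R / z ^+ 2).
Proof.
move=> C0.
have z2 : 0 < z ^+ 2 by rewrite exprn_gt0.
apply: le_trans (ler_sum _ (fun x Px => potential_flip2 O (v12 Px) (el12 Px))) _.
rewrite -mulr_sumr ler_wpM2l ?(ltW (potential_gt0 O)) // !big_split /=.
have sum_mem (vv : X -> V) : (forall o, \sum_(x | P x && (vv x == o)) 1 <= B) ->
    \sum_(x | P x) (vv x \in O)%:R <= B * #|O|%:R.
  move=> le1; rewrite (partition_big vv predT) //=.
  apply: (@le_trans _ _ (\sum_o B * (o \in O)%:R)).
    apply: ler_sum => o _; under eq_bigr => x /andP[_ /eqP ->] do rewrite -[_%:R]mul1r.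
    by rewrite -mulr_suml ler_wpM2r.
  by rewrite -mulr_sumr natr_card lexx.
rewrite mulr2n !addrA; apply: lerD; [apply: lerD; [apply: lerD|]|];
  [|exact: sum_mem|exact: sum_mem|].
  rewrite (partition_big (el \o v1) predT) //=.
  apply: (@le_trans _ _ (\sum_e A * (z ^+ 2 * (cls O e).+2%:R))).
    apply: ler_sum => e _.
    under eq_bigr => x /andP[_ /eqP ->] do rewrite -[_ * _]mul1r.
    by rewrite -mulr_suml ler_wpM2r // mulr_ge0 // ltW.
  rewrite -!mulr_sumr -natr_sum.
  suff -> : (\sum_e (cls O e).+2 = #|O| + #|E|.*2)%N by [].
  under eq_bigr => e _ do rewrite -addn2.
  by rewrite big_split /= sum_cls sum_nat_const muln2.
rewrite -mulr_suml ler_wpM2r ?invr_ge0 ?(ltW z2) //.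
pose g o o' : R := (o \in O)%:R * (o' \in O)%:R * (el o == el o')%:R * (cls O (el o))%:R^-1.
have -> : \sum_(x | P x) (v1 x \in O)%:R * (v2 x \in O)%:R * (cls O (el (v1 x)))%:R^-1
  = \sum_(x | P x) g (v1 x) (v2 x).
  by apply: eq_bigr => x Px; rewrite /g (el12 Px) eqxx mulr1.
rewrite (partition_big v1 predT) //=.
apply: (@le_trans _ _ (\sum_o \sum_o' C * g o o')).
  apply: ler_sum => o _; rewrite (partition_big v2 predT) //=.
  apply: ler_sum => o' _.
  under eq_bigr => x /andP[/andP[_ /eqP ->] /eqP ->] do rewrite -[g _ _]mul1r.
  by rewrite -mulr_suml ler_wpM2r // !mulr_ge0 ?invr_ge0.
under eq_bigr => o _ do rewrite -mulr_sumr.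
rewrite -mulr_sumr ler_wpM2l //.
apply: (@le_trans _ _ (\sum_o (o \in O)%:R)); last by rewrite natr_card.
apply: ler_sum => o _; rewrite /g; case: (boolP (o \in O)) => oO; last first.
  by rewrite big1 // => o' _; rewrite !mul0r.
rewrite -mulr_suml.
have -> : \sum_o' 1 * (o' \in O)%:R * (el o == el o')%:R = (cls O (el o))%:R :> R.
  rewrite /cls -sum1_card natr_sum [RHS]big_mkcond /=; apply: eq_bigr => o' _.
  by rewrite inE mul1r eq_sym; case: (_ \in _); case: eqP; rewrite /= ?mulr1 ?mulr0 ?mul0r.
have [->|c0] := eqVneq (cls O (el o)) 0%N; first by rewrite mul0r.
by rewrite divff // pnatr_eq0.
Qed.

End Potential.

(** * Moments of matrices whose entries are quadratic in the signs *)

Section ChaosMoment.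
Context {R : realType} {I V E X : finType}.
Variables (el : V -> E) (v1 v2 : X -> V) (lk : I -> I -> X -> bool) (wt : X -> R).
Variables (A B C W : R).

Definition chaos (s : {ffun V -> bool}) (S T : I) : R :=
  \sum_x wt x * (lk S T x)%:R * (sgnb R (s (v1 x)) * sgnb R (s (v2 x))).

(** An unnormalized Walsh coefficient of a power of the matrix. Here [t] counts the steps still to
    be made, and [O] is the set of variables used an odd number of times by the steps already
    made. *)
Definition chaos_moment t S T O : R := \sum_s chi O s * mpow (chaos s) t S T.

Lemma chaos_moment0 S T O :
  chaos_moment 0 S T O = (S == T)%:R * ((O == set0)%:R * 2 ^+ #|V|).
Proof. by rewrite /chaos_moment /= -mulr_suml sum_chi mulrC. Qed.

(** The first step of the walk is split off, and [chi_flip] absorbs its two signs into the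
    character. *)
Lemma chaos_momentS t S T O : chaos_moment t.+1 S T O =
  \sum_(y : X * I | lk S y.2 y.1)
     wt y.1 * chaos_moment t y.2 T (flip (flip O (v1 y.1)) (v2 y.1)).
Proof.
rewrite /chaos_moment /=.
transitivity (\sum_s \sum_(S' : I) \sum_(x : X) (lk S S' x)%:R * (wt x *
  (chi (flip (flip O (v1 x)) (v2 x)) s * mpow (chaos s) t S' T))).
  apply: eq_bigr => s _; rewrite mulr_sumr; apply: eq_bigr => S' _.
  rewrite /chaos mulr_suml mulr_sumr; apply: eq_bigr => x _.
  by rewrite !chi_flip -/(chaos s); ring.
rewrite exchange_big /=; under eq_bigr => S' _ do rewrite exchange_big /=.
rewrite exchange_big pair_big /= [RHS]big_mkcond /=; apply: eq_bigr => -[x S'] _ /=.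
rewrite -mulr_sumr -mulr_sumr; case: ifP => _; first by rewrite mul1r.
by rewrite mul0r.
Qed.

Hypotheses (C0 : 0 <= C) (wt0 : forall x, 0 <= wt x <= W)
  (el12 : forall x, wt x != 0 -> el (v1 x) = el (v2 x))
  (v12 : forall x, wt x != 0 -> v1 x != v2 x)
  (leA : forall S e,
     \sum_(y : X * I | (lk S y.2 y.1 && (wt y.1 != 0)) && (el (v1 y.1) == e)) 1 <= A)
  (leB1 : forall S o,
     \sum_(y : X * I | (lk S y.2 y.1 && (wt y.1 != 0)) && (v1 y.1 == o)) 1 <= B)
  (leB2 : forall S o,
     \sum_(y : X * I | (lk S y.2 y.1 && (wt y.1 != 0)) && (v2 y.1 == o)) 1 <= B)
  (leC : forall S o o', \sum_(y : X * I |
     (lk S y.2 y.1 && (wt y.1 != 0)) && (v1 y.1 == o) && (v2 y.1 == o')) 1 <= C).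

Lemma chaos_moment_le K (z : R) S T : 0 < z -> 0 <= A -> 0 <= B -> 0 <= W ->
  chaos_moment K S T set0 <= 2 ^+ #|V| * (W *
    (A * (z ^+ 2 * (K.*2 + #|E|.*2)%:R) + B * K.*2%:R *+ 2 + C * K.*2%:R / z ^+ 2)) ^+ K.
Proof.
move=> z0 A0 B0 W0.
set rate := W * _.
have z2 : 0 < z ^+ 2 by rewrite exprn_gt0.
have rate0 : 0 <= rate.
  rewrite mulr_ge0 // !addr_ge0 ?mulrn_wge0 ?mulr_ge0 ?invr_ge0 // ?mulr_ge0 //; exact: ltW.
(* The remaining [t] steps can close at most [2 t] variables, so the bound is zero for larger [O].
   This indicator keeps [#|O|] below [2 K], so that one rate serves all steps. *)
suff h t O S' : (t <= K)%N -> chaos_moment t S' T O <=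
    2 ^+ #|V| * rate ^+ t * potential el z O *+ (#|O| <= t.*2)%N.
  by have := h K set0 S (leqnn _); rewrite cards0 /= mulr1n potential0 mulr1.
elim: t O S' => [|t IH] O S' tK.
  rewrite chaos_moment0 expr0 mulr1 leqn0 cards_eq0; case: (boolP (O == set0)) => [/eqP ->|_]; last first.
    by rewrite mul0r mulr0 mulr0n.
  rewrite potential0 mulr1 mulr1n mul1r ler_piMl ?exprn_ge0 //.
  by case: eqP.
rewrite chaos_momentS.
have pge0 O' : 0 <= potential el z O' by rewrite ltW // potential_gt0.
case: (leqP #|O| t.+1.*2) => [Ole|Ogt]; last first.
  rewrite mulr0n; apply: sumr_le0 => -[x S2] _ /=.
  rewrite mulr_ge0_le0 //; first by have /andP[] := wt0 x.
  apply: le_trans (IH _ _ (ltnW tK)) _; rewrite leqNgt.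
  set f := flip _ _.
  have h1 := card_flip O (v1 x).
  have h2 := card_flip (flip O (v1 x)) (v2 x).
  by rewrite (_ : (_ < _)%N = true) // /f; lia.
rewrite mulr1n.
(* Labels of weight zero are dropped first: the two variables are known to be distinct and of equal
   class only for the others. *)
apply: (@le_trans _ _ (\sum_(y : X * I | lk S' y.2 y.1 && (wt y.1 != 0))
   2 ^+ #|V| * rate ^+ t * W * potential el z (flip (flip O (v1 y.1)) (v2 y.1)))).
  rewrite [leRHS]big_mkcondr /=; apply: ler_sum => -[x S2] _ /=.
  have [->|wx] := eqVneq; first by rewrite mul0r.
  have /andP[wx0 wxW] := wt0 x.
  apply: le_trans (ler_wpM2l wx0 (IH _ _ (ltnW tK))) _.
  set p := potential _ _ _.
  have q0 : 0 <= 2 ^+ #|V| * rate ^+ t * p.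
    by apply: mulr_ge0; [apply: mulr_ge0; exact: exprn_ge0|exact: pge0].
  apply: (@le_trans _ _ (wt x * (2 ^+ #|V| * rate ^+ t * p))).
    by rewrite ler_wpM2l //; case: (_ <= _)%N; rewrite ?mulr1n ?mulr0n.
  by rewrite [leRHS]mulrAC mulrC ler_wpM2l.
rewrite -mulr_sumr exprS.
have Psum := @potential_sum_le R V E el z z0 _ (fun y : X * I => lk S' y.2 y.1 && (wt y.1 != 0))
  (fun y => v1 y.1) (fun y => v2 y.1) A B C (fun y => fun h => el12 (andP h).2)
  (fun y => fun h => v12 (andP h).2) (leA S') (leB1 S') (leB2 S') (leC S') O C0.
have c0 : 0 <= 2 ^+ #|V| * rate ^+ t * W.
  by apply: mulr_ge0 => //; apply: mulr_ge0; exact: exprn_ge0.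
apply: le_trans (ler_wpM2l c0 Psum) _.
rewrite [leLHS](_ : _ = 2 ^+ #|V| * rate ^+ t * potential el z O * (W *
   (A * (z ^+ 2 * (#|O| + #|E|.*2)%:R) + B * #|O|%:R *+ 2 + C * #|O|%:R / z ^+ 2))); last by ring.
rewrite [leRHS](_ : _ = 2 ^+ #|V| * rate ^+ t * potential el z O * rate); last by ring.
have OK : (#|O| <= K.*2)%N by rewrite (leq_trans Ole) // leq_double.
apply: ler_wpM2l.
  by apply: mulr_ge0; [apply: mulr_ge0; exact: exprn_ge0|exact: pge0].
rewrite ler_wpM2l // !lerD //.
- by rewrite ler_wpM2l // ler_wpM2l ?(ltW z2) // ler_nat leq_add2r.
- by rewrite ler_wpM2l ?ler_nat.
- by rewrite ler_wpM2l ?ler_nat.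
- by rewrite ler_wpM2r ?invr_ge0 ?(ltW z2) // ler_wpM2l ?ler_nat.
Qed.

End ChaosMoment.

(** * Counting linked tuples *)

Definition link_floor (n q l : nat) : nat :=
  'C(l, q + q) * (n - (q + q).*2) ^ (l - (q + q)).

Section LinkCount.
Context {n q l : nat}.
Local Notation m := (q + q)%N.
Implicit Types (S T : ttuple n l) (u v w : m.-tuple 'I_n) (J : {set 'I_m}).

Lemma link1P S T u v : reflect
  (exists f : {ffun 'I_m -> 'I_l}, [/\ injective f,
     forall j, tnth S (f j) = tnth u j, forall j, tnth T (f j) = tnth v j &
     forall i, i \notin codom f -> [/\ tnth S i \notin (u : seq _) ++ v,
       tnth T i \notin (u : seq _) ++ v & tnth S i = tnth T i]])
  (link1 S T u v).
Proof.
apply: (iffP existsP) => -[f].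
  case/and3P => /injectiveP fi /forallP fj /forallP fo; exists f; split => //.
  - by move=> j; have /andP[/eqP] := fj j.
  - by move=> j; have /andP[_ /eqP] := fj j.
  by move=> i io; have /implyP/(_ io)/and3P[? ? /eqP] := fo i.
case=> fi f1 f2 fo; exists f; apply/and3P; split.
- exact/injectiveP.
- by apply/forallP => j; rewrite f1 f2 !eqxx.
- by apply/forallP => i; apply/implyP => /fo[-> -> ->]; rewrite eqxx.
Qed.

Lemma link1_sym S T u v : link1 S T u v = link1 T S v u.
Proof.
suff h S' T' u' v' : link1 S' T' u' v' -> link1 T' S' v' u' by apply/idP/idP; exact: h.
case/link1P => f [fi f1 f2 fo]; apply/link1P; exists f; split => // i /fo[h1 h2 ->].
by rewrite mem_cat orbC -mem_cat h2.
Qed.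

Lemma linked_sym S T a b c d : @linked n q l S T a b c d = linked T S a b c d.
Proof. by rewrite /linked [link1 S T _ _]link1_sym [in X in _ || X]link1_sym orbC. Qed.

Definition agree J u w := [forall j in J, tnth u j == tnth w j].

Lemma prod_if_mem J (a b : nat) :
  (\prod_(j : 'I_m) (if j \in J then a else b) = a ^ #|J| * b ^ (m - #|J|))%N.
Proof.
rewrite (bigID (mem J)) /=; congr (_ * _)%N.
  by under eq_bigr => j -> do []; rewrite prod_nat_const.
under eq_bigr => j /negPf -> do [].
rewrite prod_nat_const; congr (_ ^ _)%N.
by have := cardC (mem J); rewrite [RHS]card_ord => /(canRL (addKn _)).
Qed.

Lemma card_family_prod (T U : finType) (F : T -> {set U}) :
  #|[set f : {ffun T -> U} in family F]| = (\prod_t #|F t|)%N.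
Proof. by rewrite cardsE card_family foldrE big_map big_enum. Qed.

Definition occurrences S x : {set 'I_l} := [set i | tnth S i == x].

(** Writes the values [v] into [S] at the positions [f]. A tuple linked to [S] is recovered from [S]
    in this way. *)
Definition move S (f : {ffun 'I_m -> 'I_l}) (v : {ffun 'I_m -> 'I_n}) : ttuple n l :=
  [tuple if [pick j | f j == i] is Some j then v j else tnth S i | i < l].

(* All occurrences in [S] of a value of [u] lie among the [q + q] positions used by the link,
   so a position whose value is prescribed can be chosen in at most [q + q] ways. *)
Lemma card_link1_le S J w w' :
  (#|[set y : (m.-tuple 'I_n * m.-tuple 'I_n) * ttuple n l |
      [&& agree J y.1.1 w, agree J y.1.2 w' & link1 S y.2 y.1.1 y.1.2]]|
   <= m ^ #|J| * (l * n) ^ (m - #|J|))%N.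
Proof.
set Y := finset _.
case: (boolP [exists j in J, (m < #|occurrences S (tnth w j)|)%N]) => [/exists_inP[j jJ big]|].
  rewrite (_ : Y = set0) ?cards0 //; apply/eqP; rewrite -subset0.
  apply/fintype.subsetP => -[[u v] T]; rewrite !inE /= => /and3P[/forall_inP/(_ j jJ)/eqP uj _].
  case/link1P => f [fi f1 _ fo]; move: big; rewrite -uj ltnNge => /negP[].
  rewrite -[leqRHS](card_ord m) -(card_codom fi) subset_leq_card //.
  apply/fintype.subsetP => i; rewrite inE => /eqP Si; apply/negPn/negP => /fo[].
  by rewrite mem_cat Si mem_tnth.
rewrite negb_exists_in => /forall_inP few.
pose F j := if j \in J then occurrences S (tnth w j) else [set: 'I_l].
pose G j := if j \in J then [set tnth w' j] else [set: 'I_n].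
pose h (fv : {ffun 'I_m -> 'I_l} * {ffun 'I_m -> 'I_n}) :=
  (([tuple tnth S (fv.1 j) | j < m], [tuple fv.2 j | j < m]), move S fv.1 fv.2).
(* Positions [f] and new values determine everything: [u] is read off [S] along [f], and [T] is a
   [move] of [S]. It remains to count the choices of [f] in [F] and of values in [G]. *)
have YFG : Y \subset h @: setX [set f in family F] [set g in family G].
  apply/fintype.subsetP => -[[u v] T]; rewrite !inE /= => /and3P[/forall_inP uw /forall_inP vw].
  case/link1P => f [fi f1 f2 fo]; apply/imsetP; exists (f, [ffun j => tnth v j]).
    rewrite !inE; apply/andP; split; apply/familyP => j; rewrite ?ffunE /F /G.
      by case: ifPn; rewrite !inE // => jJ; rewrite f1 uw.
    by case: ifPn; rewrite !inE // => jJ; rewrite vw.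
  congr (_, _, _); apply: eq_from_tnth => i; rewrite tnth_mktuple ?ffunE ?f1 //.
  case: pickP => [j /eqP <-|nf]; first by rewrite ffunE f2.
  by have /fo[] : i \notin codom f by apply/codomP => -[j /eqP]; rewrite eq_sym nf.
apply: leq_trans (subset_leq_card YFG) (leq_trans (leq_imset_card _ _) _).
rewrite cardsX !card_family_prod expnMn.
have leF : (\prod_j #|F j| <= m ^ #|J| * l ^ (m - #|J|))%N.
  rewrite -prod_if_mem; apply: leq_prod => j _; rewrite /F; case: ifPn => jJ.
    by rewrite leqNgt few.
  by rewrite cardsT card_ord.
have -> : (\prod_j #|G j| = n ^ (m - #|J|))%N.
  transitivity (1 ^ #|J| * n ^ (m - #|J|))%N; last by rewrite exp1n mul1n.
  rewrite -prod_if_mem; apply: eq_bigr => j _; rewrite /G.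
  by case: ifP => _; rewrite ?cards1 // cardsT card_ord.
by rewrite mulnA leq_mul2r leF orbT.
Qed.

(* A label [(a, b), (c, d), e] stands for the monomial [Y_ace * Y_bde]. *)
Local Notation label := ((q.-tuple 'I_n * q.-tuple 'I_n) *
   (q.-tuple 'I_n * q.-tuple 'I_n) * 'I_n)%type.

Definition lab_linked S T (x : label) :=
  linked S T x.1.1.1 x.1.1.2 x.1.2.1 x.1.2.2.

(** The factor 2 accounts for the two orientations of a link. With [e] fixed, each orientation
    injects into the set of [card_link1_le], the reversed one with [w] and [w'] exchanged. *)
Lemma card_linked_le S J w w' (Z : pred (label * ttuple n l)) (e : 'I_n) :
  (forall y, Z y -> [/\ y.1.2 = e, lab_linked S y.2 y.1,
     agree J (cat_tuple y.1.1.1.1 y.1.1.1.2) w &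
     agree J (cat_tuple y.1.1.2.1 y.1.1.2.2) w']) ->
  (#|[set y | Z y]| <= 2 * (m ^ #|J| * (l * n) ^ (m - #|J|)))%N.
Proof.
move=> ZP.
pose Z1 := [set y | Z y && link1 S y.2 (cat_tuple y.1.1.1.1 y.1.1.1.2) (cat_tuple y.1.1.2.1 y.1.1.2.2)].
pose Z2 := [set y | Z y && link1 S y.2 (cat_tuple y.1.1.2.1 y.1.1.2.2) (cat_tuple y.1.1.1.1 y.1.1.1.2)].
have sub : [set y | Z y] \subset Z1 :|: Z2.
  apply/fintype.subsetP => y; rewrite !inE => Zy; rewrite Zy /=.
  by have [_] := ZP y Zy.
apply: leq_trans (subset_leq_card sub) (leq_trans (leq_card_setU _ _).1 _).
have cat_inj (a b a' b' : q.-tuple 'I_n) :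
    (a : seq _) ++ b = (a' : seq _) ++ b' -> a = a' /\ b = b'.
  move/eqP; rewrite eqseq_cat ?size_tuple // => /andP[/eqP h1 /eqP h2].
  by split; apply: val_inj.
rewrite mul2n -addnn leq_add //.
  pose h (y : label * ttuple n l) := ((cat_tuple y.1.1.1.1 y.1.1.1.2, cat_tuple y.1.1.2.1 y.1.1.2.2), y.2).
  rewrite -(@card_in_imset _ _ h); last first.
    move=> [[[[a b] [c d]] e1] T] [[[[a' b'] [c' d']] e2] T']; rewrite !inE /=.
    move=> /andP[/ZP[/= -> _ _ _] _] /andP[/ZP[/= -> _ _ _] _].
    by case=> /cat_inj[-> ->] /cat_inj[-> ->] ->.
  apply: leq_trans (card_link1_le S J w w'); apply: subset_leq_card.
  apply/fintype.subsetP => _ /imsetP[y + ->]; rewrite !inE /= => /andP[Zy ->].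
  by have [_ _ -> ->] := ZP y Zy.
pose h (y : label * ttuple n l) := ((cat_tuple y.1.1.2.1 y.1.1.2.2, cat_tuple y.1.1.1.1 y.1.1.1.2), y.2).
rewrite -(@card_in_imset _ _ h); last first.
  move=> [[[[a b] [c d]] e1] T] [[[[a' b'] [c' d']] e2] T']; rewrite !inE /=.
  move=> /andP[/ZP[/= -> _ _ _] _] /andP[/ZP[/= -> _ _ _] _].
  by case=> /cat_inj[-> ->] /cat_inj[-> ->] ->.
apply: leq_trans (card_link1_le S J w' w); apply: subset_leq_card.
apply/fintype.subsetP => _ /imsetP[y + ->]; rewrite !inE /= => /andP[Zy ->].
by have [_ _ -> ->] := ZP y Zy.
Qed.

(** Passes from the classical set of the definition to a finite set. *)
Lemma NcountE a b c d :
  @Ncount n q l a b c d = #|[set y : ttuple n l * ttuple n l | linked y.1 y.2 a b c d]|.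
Proof.
by rewrite /Ncount; apply: eq_card => y; rewrite !inE; apply/idP/idP => [/set_mem|h]; last exact/mem_set.
Qed.

(** Choose a set [I0] of [q + q] positions, write [a b] resp. [c d] there in increasing order of
    position, and fill the rest of both tuples alike, avoiding the at most [2 (q + q)] values of
    [a], [b], [c], [d]. *)
Lemma Ncount_ge a b c d : (0 < q)%N -> (m <= l)%N ->
  (link_floor n q l <= @Ncount n q l a b c d)%N.
Proof.
move=> q0 ml; rewrite /link_floor.
have m0 : (0 < m)%N by lia.
pose i0 : 'I_l := Ordinal (leq_trans m0 ml).
set u := cat_tuple a b; set v := cat_tuple c d.
pose x0 : 'I_n := tnth u (Ordinal m0).
pose supp S := [set i | tnth S i \in (u : seq _) ++ v].
pose ext (w : m.-tuple 'I_n) (I0 : {set 'I_l}) (g : {ffun 'I_l -> 'I_n}) : ttuple n l :=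
  [tuple if i \in I0 then nth x0 w (index i (enum I0)) else g i | i < l].
pose F (I0 : {set 'I_l}) i := if i \in I0 then [set x0] else [set x | x \notin (u : seq _) ++ v].
have cF (I0 : {set 'I_l}) : #|I0| = m -> ((n - m.*2) ^ (l - m) <= #|[set g in family (F I0)]|)%N.
  move=> cI; rewrite card_family_prod (bigID (mem I0)) /=.
  rewrite big1 ?mul1n => [|i iI]; last by rewrite /F iI cards1.
  have -> : (l - m)%N = #|[pred i | i \notin I0]|.
    by have := cardC (mem I0); rewrite [RHS]card_ord cI => /(canRL (addKn _)).
  rewrite -prod_nat_const; apply: leq_prod => i /negPf iI; rewrite /F iI.
  have := cardsC [set x : 'I_n | x \in (u : seq _) ++ v]; rewrite card_ord.
  have -> : ~: [set x | x \in (u : seq _) ++ v] = [set x | x \notin (u : seq _) ++ v].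
    by apply/setP => x; rewrite !inE.
  have : (#|[set x : 'I_n | x \in (u : seq _) ++ v]| <= m.*2)%N.
    by rewrite cardsE (leq_trans (card_size _)) // size_cat !size_tuple addnn.
  set A := #|_|; set B := #|_|; lia.
rewrite NcountE; set N := finset _.
(* [I0] can be recovered from the first tuple as its support, so different [I0] give disjoint
   families of pairs. *)
have -> : #|N| = (\sum_(I0 : {set 'I_l}) #|[set y in N | supp y.1 == I0]|)%N.
  rewrite -sum1_card (partition_big (fun y => supp y.1) predT) //=.
  by apply: eq_bigr => I0 _; rewrite -sum1_card; apply: eq_bigl => y; rewrite !inE.
have <- : #|[set I0 : {set 'I_l} | #|I0| == m]| = 'C(l, m) by rewrite card_draws card_ord.
rewrite -sum_nat_const [leqRHS](bigID (fun I0 : {set 'I_l} => #|I0| == m)) /=.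
apply: leq_trans (leq_addr _ _).
rewrite (eq_bigl (fun I0 : {set 'I_l} => #|I0| == m)); last by move=> I0; rewrite inE.
apply: leq_sum => I0 /eqP cI; apply: leq_trans (cF _ cI) _.
have sE : size (enum I0) = m by rewrite -cardE.
have idx_lt i : i \in I0 -> (index i (enum I0) < m)%N.
  by rewrite -mem_enum -index_mem sE.
rewrite -(@card_in_imset _ _ (fun g => (ext u I0 g, ext v I0 g))); last first.
  move=> g g'; rewrite !inE => /familyP gF /familyP g'F /(congr1 fst) /= eqS.
  apply/ffunP => i; have := congr1 (fun t => tnth t i) eqS; rewrite !tnth_mktuple.
  case: ifPn => // iI _; move: (gF i) (g'F i); rewrite /F iI !inE.
  by move=> /eqP -> /eqP ->.
apply: subset_leq_card; apply/fintype.subsetP => _ /imsetP[g + ->]; rewrite !inE /= => /familyP gF.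
have gout i : i \notin I0 -> g i \notin (u : seq _) ++ v.
  by move=> iI; have := gF i; rewrite /F (negPf iI) inE.
apply/andP; split.
  rewrite /linked; apply/orP; left; apply/link1P.
  have lt_m (j : 'I_m) : (j < size (enum I0))%N by rewrite sE.
  exists [ffun j : 'I_m => nth i0 (enum I0) j]; split.
  - move=> j j'; rewrite !ffunE => /eqP; rewrite nth_uniq ?enum_uniq //.
    by move/eqP/val_inj.
  - move=> j; rewrite ffunE tnth_mktuple -mem_enum mem_nth // index_uniq ?enum_uniq //.
    by rewrite (tnth_nth x0).
  - move=> j; rewrite ffunE tnth_mktuple -mem_enum mem_nth // index_uniq ?enum_uniq //.
    by rewrite (tnth_nth x0).
  move=> i ic; have iI : i \notin I0.
    apply: contra ic => iI; apply/codomP; exists (Ordinal (idx_lt i iI)).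
    by rewrite ffunE /= nth_index // mem_enum.
  by rewrite !tnth_mktuple (negPf iI); split => //; exact: gout.
apply/eqP/setP => i; rewrite inE tnth_mktuple; case: ifPn => iI; last exact/negbTE/gout.
by rewrite mem_cat mem_nth // size_tuple idx_lt.
Qed.

End LinkCount.

(** * The deterministic bound on the injective norm *)

Section Certificate.
Context {R : realType} {n q l : nat}.
Local Notation m := (q + q)%N.

Lemma aceE (x : 'I_n -> R) (a c : q.-tuple 'I_n) e :
  \prod_(j < m.+1) x (tnth (ace a c e) j) =
  (\prod_(i <- a) x i) * (\prod_(i <- c) x i) * x e.
Proof.
by rewrite -(big_tuple _ _ (ace a c e) predT x) /= -cats1 !big_cat big_seq1.
Qed.

Lemma ace_inj (a c b d : q.-tuple 'I_n) e e' :
  ace a c e = ace b d e' -> [/\ a = b, c = d & e = e'].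
Proof.
move/(congr1 val) => /= /rcons_inj[/eqP]; rewrite eqseq_cat ?size_tuple //.
by move=> /andP[/eqP/val_inj -> /eqP/val_inj ->] ->.
Qed.

Lemma sum_idx (F : idx n q -> R) :
  \sum_i F i = \sum_(e : 'I_n) \sum_(p : q.-tuple 'I_n * q.-tuple 'I_n) F (ace p.1 p.2 e).
Proof.
rewrite pair_big /=.
rewrite (reindex (fun x : 'I_n * (q.-tuple 'I_n * q.-tuple 'I_n) => ace x.2.1 x.2.2 x.1)) //=.
apply: onW_bij; apply: inj_card_bij.
  by move=> [e [a c]] [e' [b d]] /= /ace_inj[-> -> ->].
by rewrite !card_prod !card_tuple card_ord -expnD -expnS.
Qed.

Lemma cat_tuple_eq (a c b d : q.-tuple 'I_n) :
  (cat_tuple a c == cat_tuple b d) = ((a, c) == (b, d)).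
Proof. by rewrite -val_eqE /= eqseq_cat ?size_tuple. Qed.

Variable x : 'I_n -> R.
Hypotheses (n0 : (0 < n)%N) (x2 : forall i, x i ^+ 2 = n%:R^-1).

Lemma prod_sq_tuple k (t : k.-tuple 'I_n) :
  (\prod_(i <- t) x i) ^+ 2 = n%:R^-1 ^+ k.
Proof.
rewrite -prodrXl; under eq_bigr do rewrite x2.
by rewrite big_const_seq count_predT size_tuple iter_mulr_1.
Qed.

Lemma sum_prod_sq_tuple k : \sum_(t : k.-tuple 'I_n) (\prod_(i <- t) x i) ^+ 2 = 1.
Proof.
under eq_bigr do rewrite prod_sq_tuple.
rewrite sumr_const card_tuple card_ord -[LHS]mulr_natr natrX exprVn mulVf //.
by rewrite expf_neq0 // pnatr_eq0 -lt0n.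
Qed.

(** Off the [q + q] linked positions the two tuples agree, so each such position contributes
    [x i ^+ 2 = 1 / n]. *)
Lemma link1_prod (S T : ttuple n l) (u v : m.-tuple 'I_n) : link1 S T u v ->
  (\prod_(i <- S) x i) * (\prod_(i <- T) x i) =
  (\prod_(i <- u) x i) * (\prod_(i <- v) x i) * n%:R^-1 ^+ (l - m).
Proof.
case/link1P => f [fi f1 f2 fo]; rewrite !big_tuple -!big_split /=.
pose I0 := f @: [set: 'I_m].
rewrite (bigID (mem I0)) /=; congr (_ * _).
  rewrite big_imset /=; last exact: in2W.
  by apply: eq_big => j; rewrite ?inE // f1 f2.
rewrite (eq_bigr (fun=> n%:R^-1)) => [|i iI]; last first.
  have [|_ _ ->] := fo i; last by rewrite -expr2 x2.
  by apply: contra iI => /codomP[j ->]; rewrite imset_f.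
rewrite prodr_const; congr (_ ^+ _).
have := cardC (mem I0); rewrite [RHS]card_ord card_imset // cardsT card_ord.
by move/(canRL (addKn _)).
Qed.

Lemma linked_prod (S T : ttuple n l) (a b c d : q.-tuple 'I_n) : linked S T a b c d ->
  (\prod_(i <- S) x i) * (\prod_(i <- T) x i) =
  (\prod_(i <- a) x i) * (\prod_(i <- b) x i) * ((\prod_(i <- c) x i) * (\prod_(i <- d) x i))
  * n%:R^-1 ^+ (l - m).
Proof.
case/orP => /link1_prod ->; rewrite /= !big_cat //=.
by congr (_ * _); rewrite mulrC.
Qed.

(** For fixed [a], [b], [c], [d] all linked pairs contribute the same product by [linked_prod], and
    their number cancels the normalization by [Ncount]. *)
Lemma Mmat_form (Y : idx n q -> R) :
  (forall a b c d, (0 < @Ncount n q l a b c d)%N) ->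
  \sum_S \sum_T @Mmat R n q l Y S T * ((\prod_(i <- S) x i) * (\prod_(i <- T) x i)) =
  n%:R^-1 ^+ (l - m) * \sum_a \sum_b \sum_c \sum_d Tt Y a b c d *
  ((\prod_(i <- a) x i) * (\prod_(i <- b) x i) * ((\prod_(i <- c) x i) * (\prod_(i <- d) x i))).
Proof.
move=> N0.
transitivity (\sum_a \sum_b \sum_c \sum_d \sum_(S : ttuple n l) \sum_(T : ttuple n l)
   (Tt Y a b c d * ((Ncount l a b c d)%:R)^-1 * (if linked S T a b c d then 1 else 0)
     * ((\prod_(i <- S) x i) * (\prod_(i <- T) x i)))).
  have pull (A : finType) (F : ttuple n l -> ttuple n l -> A -> R) w :
      \sum_S \sum_T (\sum_a F S T a) * w S T = \sum_a \sum_S \sum_T F S T a * w S T.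
    rewrite [RHS]exchange_big /=; apply: eq_bigr => S _.
    by rewrite [RHS]exchange_big /=; apply: eq_bigr => T _; rewrite mulr_suml.
  rewrite /Mmat pull; apply: eq_bigr => a _; rewrite pull; apply: eq_bigr => b _.
  by rewrite pull; apply: eq_bigr => c _; rewrite pull.
rewrite mulr_sumr; apply: eq_bigr => a _.
rewrite mulr_sumr; apply: eq_bigr => b _.
rewrite mulr_sumr; apply: eq_bigr => c _.
rewrite mulr_sumr; apply: eq_bigr => d _.
set w := (X in _ = _ * (_ * X)).
transitivity (\sum_(y : ttuple n l * ttuple n l | linked y.1 y.2 a b c d)
   (Tt Y a b c d * ((Ncount l a b c d)%:R)^-1 * (w * n%:R^-1 ^+ (l - m)))).
  rewrite pair_big /= [RHS]big_mkcond /=; apply: eq_bigr => y _.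
  case: ifP => [/linked_prod ->|_]; first by rewrite mulr1.
  by rewrite mulr0 mul0r.
rewrite -mulr_suml sumr_const.
have -> : #|[pred y : ttuple n l * ttuple n l | linked y.1 y.2 a b c d]| = Ncount l a b c d.
  by rewrite NcountE cardsE.
rewrite -[X in X * _ = _]mulr_natr mulfVK; first by ring.
by rewrite pnatr_eq0 -lt0n.
Qed.

Lemma injective_form_sq_le (Y : idx n q -> R) :
  (forall i, Y i ^+ 2 = 1) -> (forall a b c d, (0 < @Ncount n q l a b c d)%N) ->
  (\sum_(i : idx n q) Y i * \prod_(j < m.+1) x (tnth i j)) ^+ 2 <=
  n%:R + n%:R ^+ (l - m) * opnorm (@Mmat R n q l Y).
Proof.
move=> Y2 N0.
have nN0 : n%:R != 0 :> R by rewrite pnatr_eq0 -lt0n.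
pose W (t : seq 'I_n) := \prod_(i <- t) x i.
pose zeta e := \sum_(p : q.-tuple 'I_n * q.-tuple 'I_n) Y (ace p.1 p.2 e) * (W p.1 * W p.2).
have -> : \sum_(i : idx n q) Y i * \prod_(j < m.+1) x (tnth i j) = \sum_e x e * zeta e.
  rewrite sum_idx; apply: eq_bigr => e _; rewrite mulr_sumr; apply: eq_bigr => p _.
  by rewrite aceE -!/(W _); ring.
apply: le_trans (cauchy_schwarz _ _) _.
have -> : \sum_i x i ^+ 2 = 1.
  by under eq_bigr do rewrite x2; rewrite sumr_const card_ord -[LHS]mulr_natr mulVf.
rewrite mul1r.
have -> : \sum_e zeta e ^+ 2 = n%:R + n%:R ^+ (l - m) *
    \sum_S \sum_T @Mmat R n q l Y S T * (W S * W T).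
  rewrite Mmat_form // -!/(W _) mulrA -exprMn divff // expr1n mul1r.
  transitivity (\sum_(p : q.-tuple 'I_n * q.-tuple 'I_n)
      \sum_(r : q.-tuple 'I_n * q.-tuple 'I_n)
      (W p.1 * W p.2 * (W r.1 * W r.2)) * \sum_e Y (ace p.1 p.2 e) * Y (ace r.1 r.2 e)).
    under eq_bigr => e _ do rewrite expr2 mulr_suml.
    rewrite exchange_big /=; apply: eq_bigr => p _.
    under eq_bigr => e _ do rewrite mulr_sumr.
    rewrite exchange_big /=; apply: eq_bigr => r _.
    by rewrite mulr_sumr; apply: eq_bigr => e _; ring.
  (* Here [p] is [(a, c)] and [r] is [(b, d)]. On the diagonal the sum over [e] equals [n] as [Y]
     has entries of square one, and these terms add up to [n]; off the diagonal it is [Tt]. *)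
  transitivity (\sum_(p : q.-tuple 'I_n * q.-tuple 'I_n)
      \sum_(r : q.-tuple 'I_n * q.-tuple 'I_n)
      ((r == p)%:R * (n%:R * (W p.1 * W p.2) ^+ 2) +
       Tt Y p.1 r.1 p.2 r.2 * (W p.1 * W r.1 * (W p.2 * W r.2)))).
    apply: eq_bigr => p _; apply: eq_bigr => r _.
    rewrite /Tt cat_tuple_eq -!surjective_pairing eq_sym.
    case: eqP => [->|_] /=; last by ring.
    rewrite (eq_bigr (fun=> 1)) => [|e _]; last by rewrite -expr2 Y2.
    by rewrite sumr_const card_ord; ring.
  under eq_bigr => p _ do rewrite big_split /=.
  rewrite big_split /=; congr (_ + _).
    transitivity (\sum_(p : q.-tuple 'I_n * q.-tuple 'I_n) n%:R * (W p.1 * W p.2) ^+ 2).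
      apply: eq_bigr => p _; rewrite (bigD1 p) //= eqxx mul1r big1 ?addr0 // => r /negPf ->.
      by rewrite mul0r.
    rewrite -mulr_sumr -[RHS]mulr1; congr (_ * _).
    under eq_bigr => p _ do rewrite exprMn.
    rewrite -(pair_bigA _ (fun a c : q.-tuple 'I_n => W a ^+ 2 * W c ^+ 2)) /=.
    under eq_bigr => a _ do rewrite -mulr_sumr sum_prod_sq_tuple mulr1.
    exact: sum_prod_sq_tuple.
  rewrite -(pair_bigA _ (fun a c => \sum_r Tt Y a r.1 c r.2 * (W a * W r.1 * (W c * W r.2)))) /=.
  apply: eq_bigr => a _; rewrite [RHS]exchange_big /=; apply: eq_bigr => c _.
  by rewrite -(pair_bigA _ (fun b d => Tt Y a b c d * (W a * W b * (W c * W d)))).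
rewrite lerD2l ler_wpM2l ?exprn_ge0 //.
exact: (quadratic_form_le_opnorm _ (sum_prod_sq_tuple l)).
Qed.

End Certificate.

Lemma inj_norm_le {R : realType} {n q l : nat} (Y : idx n q -> R) : (0 < n)%N -> (q + q <= l)%N ->
  (forall i, Y i = 1 \/ Y i = -1) -> (forall a b c d, (0 < @Ncount n q l a b c d)%N) ->
  inj_norm Y <= Num.sqrt (n%:R) +
    powR (n%:R) (l%:R / 2 - q%:R) * Num.sqrt (opnorm (@Mmat R n q l Y)).
Proof.
move=> n0 ml Y1 N0.
have n_gt0 : 0 < n%:R :> R by rewrite ltr0n.
have rhs0 : 0 <= Num.sqrt (n%:R) +
    powR (n%:R) (l%:R / 2 - q%:R) * Num.sqrt (opnorm (@Mmat R n q l Y)).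
  by rewrite addr_ge0 ?mulr_ge0 ?sqrtr_ge0 ?powR_ge0.
rewrite /inj_norm; apply: bigmax_le => // x _.
have x2 i : (sgnb R (x i) / Num.sqrt n%:R) ^+ 2 = n%:R^-1.
  by rewrite exprMn exprVn sqr_sqrtr ?(ltW n_gt0) // expr2 sgnb_sq mul1r.
have Y2 i : Y i ^+ 2 = 1 by case: (Y1 i) => ->; rewrite ?sqrrN expr1n.
have := injective_form_sq_le n0 x2 Y2 N0.
set form := \sum_i _; set op := opnorm _ => le_sq.
(* The norm must be nonnegative for its square root to square back to it. *)
have op0 : 0 <= op.
  have := opnorm_ub (@Mmat R n q l Y) (x := fun S : ttuple n l =>
    \prod_(i <- S) (sgnb R (x i) / Num.sqrt n%:R)) (sum_prod_sq_tuple n0 x2 l).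
  exact: le_trans (sqrtr_ge0 _).
have powE : powR (n%:R) (l%:R / 2 - q%:R) ^+ 2 = n%:R ^+ (l - (q + q)) :> R.
  rewrite -powR_mulrn ?powR_ge0 // -powRrM -powR_mulrn ?(ltW n_gt0) //; congr powR.
  by rewrite natrB // natrD; field.
rewrite -(ler_pXn2r (n := 2)) ?nnegrE // real_normK ?num_real //.
apply: le_trans le_sq _.
rewrite sqrrD exprMn powE !sqr_sqrtr ?(ltW n_gt0) // -addrA lerD2l lerDr.
by rewrite mulrn_wge0 // !mulr_ge0 ?sqrtr_ge0 ?powR_ge0.
Qed.

(** * The matrix [Mmat] as a chaos over labels, with its counting constants *)

Section LabelledChaos.
Context {R : realType} {n q l : nat}.
Local Notation m := (q + q)%N.
Local Notation label := ((q.-tuple 'I_n * q.-tuple 'I_n) *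
   (q.-tuple 'I_n * q.-tuple 'I_n) * 'I_n)%type.

Definition var1 (x : label) : idx n q := ace x.1.1.1 x.1.2.1 x.2.
Definition var2 (x : label) : idx n q := ace x.1.1.2 x.1.2.2 x.2.

Definition lab_weight (x : label) : R :=
  (Ncount l x.1.1.1 x.1.1.2 x.1.2.1 x.1.2.2)%:R^-1 *
  (cat_tuple x.1.1.1 x.1.2.1 != cat_tuple x.1.1.2 x.1.2.2)%:R.

Definition last_index (i : idx n q) : 'I_n := tnth i ord_max.

Lemma last_index_ace (a c : q.-tuple 'I_n) e : last_index (ace a c e) = e.
Proof.
by rewrite /last_index (tnth_nth e) /= nth_rcons size_cat !size_tuple ltnn eqxx.
Qed.

Lemma Mmat_chaos s (S T : ttuple n l) :
  Mmat (Ysign R s) S T = chaos var1 var2 lab_linked lab_weight s S T.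
Proof.
rewrite /chaos -(pair_bigA _ (fun p e => lab_weight (p, e) * (lab_linked S T (p, e))%:R *
  (sgnb R (s (var1 (p, e))) * sgnb R (s (var2 (p, e)))))) /=.
rewrite -(pair_bigA _ (fun ab cd => \sum_e lab_weight (ab, cd, e) *
  (lab_linked S T (ab, cd, e))%:R *
  (sgnb R (s (var1 (ab, cd, e))) * sgnb R (s (var2 (ab, cd, e)))))) /=.
rewrite -(pair_bigA _ (fun a b => \sum_cd \sum_e lab_weight (a, b, cd, e) *
  (lab_linked S T (a, b, cd, e))%:R *
  (sgnb R (s (var1 (a, b, cd, e))) * sgnb R (s (var2 (a, b, cd, e)))))) /=.
rewrite /Mmat; apply: eq_bigr => a _; apply: eq_bigr => b _.
rewrite -(pair_bigA _ (fun c d => \sum_e lab_weight (a, b, (c, d), e) *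
  (lab_linked S T (a, b, (c, d), e))%:R *
  (sgnb R (s (var1 (a, b, (c, d), e))) * sgnb R (s (var2 (a, b, (c, d), e)))))) /=.
apply: eq_bigr => c _; apply: eq_bigr => d _.
rewrite /lab_weight /lab_linked /Tt /Ysign /= -mulr_sumr /var1 /var2 /=.
by case: ifP => _; case: ifP => _; rewrite ?mulr1 ?mulr0 ?mul0r // mulrC.
Qed.

Lemma sum1_natr (T : finType) (P : pred T) : \sum_(x | P x) 1 = #|[set x | P x]|%:R :> R.
Proof. by rewrite -sum1_card natr_sum; apply: eq_bigl => x; rewrite inE. Qed.

(** Fixing the variable [Y_ace] prescribes [a] in [a b] and [c] in [c d], the first half of both
    tuples; fixing [Y_bde] prescribes the second halves. *)
Definition first_half : {set 'I_m} := lshift q @: [set: 'I_q].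
Definition second_half : {set 'I_m} := @rshift q q @: [set: 'I_q].

Lemma card_first_half : #|first_half| = q.
Proof. by rewrite card_imset ?cardsT ?card_ord //; exact: lshift_inj. Qed.

Lemma card_second_half : #|second_half| = q.
Proof. by rewrite card_imset ?cardsT ?card_ord //; exact: rshift_inj. Qed.

Lemma agree_first (a b b' : q.-tuple 'I_n) :
  agree first_half (cat_tuple a b) (cat_tuple a b').
Proof. by apply/forall_inP => _ /imsetP[j _ ->]; rewrite !tnth_lshift. Qed.

Lemma agree_second (a a' b : q.-tuple 'I_n) :
  agree second_half (cat_tuple a b) (cat_tuple a' b).
Proof. by apply/forall_inP => _ /imsetP[j _ ->]; rewrite !tnth_rshift. Qed.

Lemma agree_refl (J : {set 'I_m}) (u : m.-tuple 'I_n) : agree J u u.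
Proof. by apply/forall_inP. Qed.

Implicit Types S : ttuple n l.
Let live S (y : label * ttuple n l) := lab_linked S y.2 y.1 && (lab_weight y.1 != 0).

(** The constant [A]: nothing but [e] is prescribed, so [J] is empty and the two reference tuples
    are dummies. *)
Lemma count_free S e :
  \sum_(y | live S y && (last_index (var1 y.1) == e)) 1 <= (2 * (l * n) ^ m)%:R :> R.
Proof.
rewrite sum1_natr ler_nat.
have := @card_linked_le n q l S set0 (nseq_tuple m e) (nseq_tuple m e)
  (fun y => live S y && (last_index (var1 y.1) == e)) e.
rewrite cards0 expn0 mul1n subn0; apply => y /andP[/andP[lk _]].
rewrite /var1 last_index_ace => /eqP ye; split => //.
  by apply/forall_inP => j; rewrite inE.
by apply/forall_inP => j; rewrite inE.
Qed.

(** Any one element satisfying [P] supplies the reference tuples. Halves prescribed give the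
    constant [B], whole tuples the constant [C]. *)
Lemma count_fixed (P : pred (label * ttuple n l)) S (J : {set 'I_m}) :
  (forall y y', P y -> P y' -> [/\ y'.1.2 = y.1.2,
     agree J (cat_tuple y'.1.1.1.1 y'.1.1.1.2) (cat_tuple y.1.1.1.1 y.1.1.1.2) &
     agree J (cat_tuple y'.1.1.2.1 y'.1.1.2.2) (cat_tuple y.1.1.2.1 y.1.1.2.2)]) ->
  \sum_(y | live S y && P y) 1 <= (2 * (m ^ #|J| * (l * n) ^ (m - #|J|)))%:R :> R.
Proof.
move=> Pagree; rewrite sum1_natr ler_nat.
have [y0 /= /andP[_ Py0]|none] := pickP (fun y => live S y && P y); last first.
  rewrite (_ : finset _ = set0) ?cards0 //; apply/setP => y.
  by rewrite !inE none.
apply: (@card_linked_le n q l S J (cat_tuple y0.1.1.1.1 y0.1.1.1.2)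
  (cat_tuple y0.1.1.2.1 y0.1.1.2.2) _ y0.1.2) => y /andP[/andP[lk _] Py].
by have [? ? ?] := Pagree _ _ Py0 Py.
Qed.

Lemma count_var1 S o :
  \sum_(y | live S y && (var1 y.1 == o)) 1 <= (2 * (m ^ q * (l * n) ^ q))%:R :> R.
Proof.
rewrite -[X in (_ ^ X * _)%N]card_first_half -[X in (_ * (_ ^ X))%N](addKn q).
rewrite -[X in (_ - X)%N]card_first_half.
apply: (count_fixed (P := fun y => var1 y.1 == o)) => y y' /eqP <- /eqP/ace_inj[].
case: y => [[[[a b] [c d]] e] T]; case: y' => [[[[a' b'] [c' d']] e'] T'] /= -> -> ->.
by split => //; exact: agree_first.
Qed.

Lemma count_var2 S o :
  \sum_(y | live S y && (var2 y.1 == o)) 1 <= (2 * (m ^ q * (l * n) ^ q))%:R :> R.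
Proof.
rewrite -[X in (_ ^ X * _)%N]card_second_half -[X in (_ * (_ ^ X))%N](addKn q).
rewrite -[X in (_ - X)%N]card_second_half.
apply: (count_fixed (P := fun y => var2 y.1 == o)) => y y' /eqP <- /eqP/ace_inj[].
case: y => [[[[a b] [c d]] e] T]; case: y' => [[[[a' b'] [c' d']] e'] T'] /= -> -> ->.
by split => //; exact: agree_second.
Qed.

Lemma count_both S o o' :
  \sum_(y | live S y && (var1 y.1 == o) && (var2 y.1 == o')) 1 <= (2 * m ^ m)%:R :> R.
Proof.
under eq_bigl => y do rewrite -andbA.
have -> : (2 * m ^ m = 2 * (m ^ #|[set: 'I_m]| * (l * n) ^ (m - #|[set: 'I_m]|)))%N.
  by rewrite cardsT card_ord subnn muln1.
apply: (count_fixed (P := fun y => (var1 y.1 == o) && (var2 y.1 == o'))).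
move=> y y' /andP[/eqP <- /eqP <-] /andP[/eqP/ace_inj[] ++ + /eqP/ace_inj[]].
case: y => [[[[a b] [c d]] e] T]; case: y' => [[[[a' b'] [c' d']] e'] T'] /=.
by move=> -> -> -> -> -> _; split => //; exact: agree_refl.
Qed.

(** Each of the [n ^ l] diagonal entries, summed over the signs, is a [chaos_moment] at the empty
    set, whose character is 1. The weights are at most [1 / N1]. *)
Lemma trace_moment_le (N1 K : nat) (z : R) : 0 < z -> (0 < N1)%N ->
  (forall a b c d, (N1 <= @Ncount n q l a b c d)%N) ->
  \sum_s \sum_S mpow (@Mmat R n q l (Ysign R s)) K S S <=
  n%:R ^+ l * (2 ^+ #|{: idx n q}| * (N1%:R^-1 *
    ((2 * (l * n) ^ m)%:R * (z ^+ 2 * (K.*2 + n.*2)%:R) +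
     (2 * (m ^ q * (l * n) ^ q))%:R * K.*2%:R *+ 2 + (2 * m ^ m)%:R * K.*2%:R / z ^+ 2)) ^+ K).
Proof.
move=> z0 N10 N1le; rewrite exchange_big /=.
have -> : n%:R ^+ l = #|{: ttuple n l}|%:R :> R by rewrite card_tuple card_ord natrX.
rewrite [leRHS]mulr_natl -sumr_const; apply: ler_sum => S _.
have wt0 (x : label) : 0 <= lab_weight x <= N1%:R^-1.
  have lew : (Ncount l x.1.1.1 x.1.1.2 x.1.2.1 x.1.2.2)%:R^-1 <= N1%:R^-1 :> R.
    by rewrite lef_pV2 ?posrE ?ltr0n ?ler_nat // (leq_trans N10).
  rewrite /lab_weight; case: (_ != _); rewrite ?mulr1 ?mulr0 ?invr_ge0 ?lew ?andbT //.
  by rewrite lexx ler0n.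
have el12 (x : label) : lab_weight x != 0 -> last_index (var1 x) = last_index (var2 x).
  by move=> _; rewrite !last_index_ace.
have v12 (x : label) : lab_weight x != 0 -> var1 x != var2 x.
  apply: contra => /eqP/ace_inj[e1 e2 _].
  by rewrite /lab_weight e1 e2 eqxx mulr0.
have := @chaos_moment_le R _ _ _ _ last_index var1 var2 lab_linked lab_weight
  _ _ _ _ (ler0n _ _) wt0 el12 v12 count_free count_var1 count_var2 count_both K z S S z0.
rewrite card_ord => /(_ (ler0n _ _) (ler0n _ _)).
rewrite invr_ge0 => /(_ (ler0n _ _)); apply: le_trans.
rewrite /chaos_moment ler_sum // => s _.
rewrite /chi big1 ?mul1r => [|v]; last by rewrite inE.
suff E t S1 S2 : mpow (@Mmat R n q l (Ysign R s)) t S1 S2 =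
    mpow (chaos var1 var2 lab_linked lab_weight s) t S1 S2 by rewrite E.
elim: t S1 S2 => [//|t IH] S1 S2 /=; apply: eq_bigr => U _.
by rewrite IH Mmat_chaos.
Qed.

End LabelledChaos.

(** * From the trace moment to the tail probability *)

Section Tail.
Context {R : realType} {n q l : nat}.
Local Notation m := (q + q)%N.

Lemma Mmat_sym (Y : idx n q -> R) (S T : ttuple n l) : Mmat Y S T = Mmat Y T S.
Proof.
rewrite /Mmat; apply: eq_bigr => a _; apply: eq_bigr => b _.
by apply: eq_bigr => c _; apply: eq_bigr => d _; rewrite linked_sym.
Qed.

Lemma rad_probC (P : (idx n q -> R) -> bool) :
  rad_prob P = 1 - #|[set s | ~~ P (Ysign R s)]|%:R / 2 ^+ #|{: idx n q}|.
Proof.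
have two0 : 2 ^+ #|{: idx n q}| != 0 :> R by rewrite expf_neq0 // pnatr_eq0.
rewrite /rad_prob natrX.
have -> : #|([set s | P (Ysign R s)])%classic| = #|[set s | P (Ysign R s)]|.
  by apply: eq_card => s; rewrite !inE; apply/idP/idP => [/set_mem|h]; last exact/mem_set.
have := cardsC [set s | P (Ysign R s)].
rewrite card_ffun card_bool (_ : ~: _ = [set s | ~~ P (Ysign R s)]); last first.
  by apply/setP => s; rewrite !inE.
move=> /(congr1 (fun k : nat => k%:R : R)); rewrite natrD natrX => /(canRL (addrK _)) ->.
by rewrite mulrBl divff.
Qed.

(** Markov's inequality for the trace of an even power, which is a sum of squares. The ratio
    [rate / tau] is at most [1 / e], so its [2 k]-th power is at most [n ^ (- 2 l)]; the trace loses
    a factor [n ^ l], and [n ^ (- l)] remains. *)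
Lemma rad_prob_opnorm_ge (P : (idx n q -> R) -> bool) (tau rate : R) (k : nat) :
  (0 < n)%N -> (0 < k)%N -> 0 < tau -> 0 <= rate -> expR 1 * rate <= tau ->
  (n%:R ^+ l) ^+ 2 <= expR 1 ^+ (k + k) :> R ->
  \sum_s \sum_S mpow (@Mmat R n q l (Ysign R s)) (k + k) S S <=
    n%:R ^+ l * (2 ^+ #|{: idx n q}| * rate ^+ (k + k)) ->
  (forall s, opnorm (@Mmat R n q l (Ysign R s)) <= tau -> P (Ysign R s)) ->
  1 - (n%:R ^+ l)^-1 <= rad_prob P.
Proof.
move=> n0 k0 tau0 rate0 rate_tau n_e tr_le goodP.
have nl0 : 0 < n%:R ^+ l :> R by rewrite exprn_gt0 // ltr0n.
have two0 : 0 < 2 ^+ #|{: idx n q}| :> R by rewrite exprn_gt0.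
have e0 : 0 < expR 1 :> R by exact: expR_gt0.
rewrite rad_probC lerD2l lerN2 ler_pdivrMr //.
set bad := finset _.
pose tr s := \sum_S mpow (@Mmat R n q l (Ysign R s)) (k + k) S S.
have tr0 s : 0 <= tr s.
  apply: sumr_ge0 => S _; rewrite mpowD; apply: sumr_ge0 => T _.
  by rewrite [X in _ * X](mpow_sym _ (Mmat_sym _)) -expr2 sqr_ge0.
have tr_bad s : s \in bad -> tau ^+ (k + k) <= tr s.
  rewrite inE; apply: contraR; rewrite -ltNge => /ltW tr_small; apply: goodP.
  apply: (opnorm_le_of_trace _ k0 (ltW tau0) (Mmat_sym _) tr_small).
  by rewrite card_tuple card_ord expn_gt0 n0.
have markov : #|bad|%:R * tau ^+ (k + k) <= n%:R ^+ l * (2 ^+ #|{: idx n q}| * rate ^+ (k + k)).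
  apply: le_trans tr_le; rewrite [leRHS](bigID (mem bad)) /= mulr_natl -sumr_const.
  rewrite -[leLHS]addr0; apply: lerD; first exact: ler_sum.
  by apply: sumr_ge0 => s _; exact: tr0.
have tauK : (n%:R ^+ l) ^+ 2 * rate ^+ (k + k) <= tau ^+ (k + k).
  apply: le_trans (ler_wpM2r (exprn_ge0 _ rate0) n_e) _.
  rewrite -exprMn; apply: lerXn2r => //; rewrite nnegrE; last exact: ltW.
  exact: mulr_ge0 (ltW e0) rate0.
have {}tauK : #|bad|%:R * ((n%:R ^+ l) ^+ 2 * rate ^+ (k + k)) <=
    n%:R ^+ l * (2 ^+ #|{: idx n q}| * rate ^+ (k + k)).
  by apply: le_trans markov; rewrite ler_wpM2l.
(* The power of [rate] is cancelled below; when it vanishes, the Markov bound itself shows that no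
   sign pattern is bad. *)
have [rate_eq0|rate_neq0] := eqVneq rate 0.
  move: markov; rewrite rate_eq0 expr0n gtn_eqF ?addn_gt0 ?k0 //= !mulr0 pmulr_lle0 ?exprn_gt0 //.
  move=> bad0; apply: le_trans bad0 _; rewrite mulr_ge0 ?invr_ge0 //; exact: ltW.
have rk0 : 0 < rate ^+ (k + k) by rewrite exprn_gt0 // lt0r rate_neq0.
rewrite mulrC ler_pdivlMr // -(ler_pM2r rk0) -(ler_pM2l nl0).
by move: tauK; congr (_ <= _); ring.
Qed.

End Tail.

(** * Numerical estimates and choice of parameters *)

Lemma expn_le_bin m l : (m <= l)%N -> (l ^ m <= m ^ m * 'C(l, m))%N.
Proof.
elim: m l => [|m IH] [|l] //; rewrite ltnS => ml.
rewrite !expnS -[X in (_ <= X)%N]mulnA [(m.+1 ^ m * _)%N]mulnC mulnA -mul_bin_diag -mulnA.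
rewrite leq_mul2l /=; case: m ml IH => [|m] ml IH; first by rewrite bin0.
have IHl := IH l ml.
(* Since [m < l] here, [(l + 1) / (m + 2) <= l / (m + 1)]; clearing denominators reduces the goal to
   the induction hypothesis. *)
rewrite -(@leq_pmul2r (m.+1 ^ m.+1)) ?expn_gt0 // -expnMn.
apply: (@leq_trans ((m.+2 * l) ^ m.+1)); first by rewrite leq_exp2r //; nia.
by rewrite expnMn [('C(l, m.+1) * _)%N]mulnC -mulnA leq_mul2l mulnC IHl orbT.
Qed.

Lemma bernoulli_le {R : realDomainType} (y : R) k : 0 <= y <= 1 -> 1 - k%:R * y <= (1 - y) ^+ k.
Proof.
move=> /andP[y0 y1]; elim: k => [|k IH]; first by rewrite mul0r subr0 expr0.
rewrite exprS -natr1; apply: le_trans (ler_wpM2l _ IH); last by rewrite subr_ge0.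
have : 0 <= k%:R * (y * y) by rewrite !mulr_ge0.
by lra.
Qed.

Section Arithmetic.
Context {R : realType} {n q l : nat}.
Local Notation m := (q + q)%N.
Hypotheses (q0 : (1 <= q)%N) (ml : (m <= l)%N) (ln4 : (4 * m * l <= n)%N).

Lemma link_floor_gt0 : (0 < link_floor n q l)%N.
Proof. by rewrite muln_gt0 bin_gt0 ml expn_gt0 subn_gt0; apply/orP; left; nia. Qed.

(** The binomial is at least [(l / m) ^ m]. By Bernoulli, [(1 - 2 m / n) ^ (l - m)] is at least
    [1 - 2 m l / n], hence at least [1 / 2] when [4 m l <= n]. *)
Lemma link_count_lower :
  (l%:R / m%:R) ^+ m * n%:R ^+ (l - m) / 2 <= (link_floor n q l)%:R :> R.
Proof.
rewrite /link_floor.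
have m0 : 0 < m%:R :> R by rewrite ltr0n; lia.
have n0 : 0 < n%:R :> R by rewrite ltr0n; nia.
rewrite natrM -mulrA ler_pM ?exprn_ge0 ?divr_ge0 ?mulr_ge0 ?exprn_ge0 ?ler0n //.
  rewrite exprMn exprVn ler_pdivrMr ?exprn_gt0 // mulrC -!natrX -natrM ler_nat.
  exact: expn_le_bin.
have mn : (m.*2 <= n)%N by nia.
rewrite natrX natrB //.
have -> : n%:R - m.*2%:R = n%:R * (1 - m.*2%:R / n%:R) :> R by field; rewrite gt_eqF.
rewrite exprMn ler_wpM2l ?exprn_ge0 ?ler0n //.
have := @bernoulli_le R (m.*2%:R / n%:R) (l - m).
rewrite divr_ge0 ?ler0n // ler_pdivrMr // mul1r ler_nat mn => /(_ isT).
apply: le_trans; have : (l - m)%:R * (m.*2%:R / n%:R) <= 2^-1 :> R; last by lra.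
rewrite mulrA ler_pdivrMr // [leRHS]mulrC ler_pdivlMr // -!natrM ler_nat.
by nia.
Qed.

End Arithmetic.

Lemma rate_ge0 {F : realFieldType} (a b c d e : nat) (w : F) : 0 <= w ->
  0 <= a%:R * (w * d%:R) + b%:R * e%:R *+ 2 + c%:R * e%:R / w.
Proof.
move=> w0; apply: addr_ge0; first apply: addr_ge0.
- by rewrite !mulr_ge0 ?ler0n.
- by rewrite mulrn_wge0 // mulr_ge0 ?ler0n.
- by rewrite !mulr_ge0 ?invr_ge0 ?ler0n.
Qed.

(** The value [kap * s / L] of [z ^+ 2] balances opening against closing. The total is
    [kap * L * s * n] times [4 s ^ 2 + 8 s + 8], and [2 s ^ 2 <= 1] keeps the last factor below
    18. *)
Lemma rate_bound {F : realFieldType} (L kap s n K : F) : 0 < L -> 0 < kap -> 0 < s ->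
  0 <= n -> K = s ^+ 2 * n -> 2 * s ^+ 2 <= 1 ->
  2 * L ^+ 2 * (kap * s / L * (2 * K + 2 * n)) + 2 * (2 * (kap * L) * (2 * K)) +
    2 * kap ^+ 2 * (2 * K) / (kap * s / L) <= 18 * (kap * L) * (s * n).
Proof.
move=> L0 kap0 s0 n0 -> s2.
have -> : 2 * L ^+ 2 * (kap * s / L * (2 * (s ^+ 2 * n) + 2 * n)) +
    2 * (2 * (kap * L) * (2 * (s ^+ 2 * n))) +
    2 * kap ^+ 2 * (2 * (s ^+ 2 * n)) / (kap * s / L) =
    kap * L * (s * n) * (4 * s ^+ 2 + 8 * s + 8).
  by field; rewrite !gt_eqF.
rewrite [leRHS](_ : _ = kap * L * (s * n) * 18); last by ring.
apply: ler_wpM2l; first by rewrite !mulr_ge0 // ltW.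
by nra.
Qed.

Section Constants.
Context {R : realType} {n q l : nat}.
Local Notation m := (q + q)%N.
Hypotheses (q0 : (1 <= q)%N) (ml : (m <= l)%N) (ln4 : (4 * m * l <= n)%N).

Lemma expR1_le4 : expR 1 <= 4 :> R.
Proof.
have h : 2^-1 <= expR (- 2^-1) :> R by have := expR_ge1Dx (- 2^-1 : R); lra.
have e0 : 0 < expR (2^-1) :> R := expR_gt0 _.
have e2 : expR (2^-1) <= 2 :> R.
  rewrite -[leRHS]invrK -[leLHS]invrK lef_pV2 ?posrE ?invr_gt0 // -expRN //.
have -> : 1 = 2^-1 + 2^-1 :> R by field.
by rewrite expRD; nra.
Qed.

Lemma ln_n_ge1 : 1 <= ln (n%:R : R).
Proof.
rewrite -[leLHS]expRK ler_ln ?posrE ?expR_gt0 //; last by rewrite ltr0n; nia.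
by apply: le_trans expR1_le4 _; rewrite ler_nat; nia.
Qed.

(** Here [288 = 4 * 2 * 18 * 2]: the bound 4 for [e], the halving in [link_count_lower], the
    constant of [rate_bound], and the factor in [s * n <= 2 g]. The power of [m] joins [m ^ m] from
    the link count and [m ^ q] from [kap]. The right side is the square of [8 p ^ p], and
    [p ^ 2 >= 9] suffices. *)
Lemma constants_le : (288 * m ^ (3 * q) <= 64 * (m.+1 ^ m.+1) ^ 2)%N.
Proof.
have -> : ((m.+1 ^ m.+1) ^ 2 = m.+1 ^ 2 * (m.+1 ^ q * m.+1 ^ (3 * q)))%N.
  by rewrite -expnM -!expnD; congr (_ ^ _)%N; lia.
have h1 : (m ^ (3 * q) <= m.+1 ^ (3 * q))%N by rewrite leq_exp2r //; lia.
have h2 : (0 < m.+1 ^ q)%N by rewrite expn_gt0.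
have h3 : (9 <= m.+1 ^ 2)%N by rewrite (@leq_exp2r 3 _ 2) //; lia.
have h4 : (m.+1 ^ (3 * q) <= m.+1 ^ q * m.+1 ^ (3 * q))%N by rewrite leq_pmull.
apply: (@leq_trans (64 * (9 * m.+1 ^ (3 * q)))); first by lia.
by rewrite leq_mul2l /= leq_mul.
Qed.

(* The bound of the theorem without its summand [n^(1/2)], divided by [n^(l/2 - q)] and squared. *)
Definition threshold : R :=
  (8 * (m.+1%:R) ^+ m.+1 * powR (l%:R) (2^-1 - m.+1%:R / 4)
     * powR (n%:R) (m.+1%:R / 4) * powR (ln (n%:R)) (4^-1)
   / powR (n%:R) (l%:R / 2 - q%:R)) ^+ 2.

Lemma powR_half_exponent : powR (n%:R : R) (l%:R / 2 - q%:R) ^+ 2 = n%:R ^+ (l - m).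
Proof.
rewrite -powR_mulrn ?powR_ge0 // -powRrM -powR_mulrn ?ler0n //; congr powR.
by rewrite natrB // natrD; field.
Qed.

Lemma thresholdE : threshold = 64 * ((m.+1%:R) ^+ m.+1) ^+ 2 *
   n%:R ^+ q * Num.sqrt (n%:R * (l%:R * ln n%:R)) / (l%:R ^+ q * n%:R ^+ (l - m)).
Proof.
have n0 : 0 < n%:R :> R by rewrite ltr0n; nia.
have l0 : 0 < l%:R :> R by rewrite ltr0n; lia.
have y0 : 0 <= ln (n%:R : R) by apply: le_trans ln_n_ge1.
rewrite /threshold exprMn exprVn powR_half_exponent 4!exprMn.
have pE : m.+1%:R = 2 * q%:R + 1 :> R by rewrite -(addn1 m) natrD (natrD _ q q); ring.
have lE : powR (l%:R : R) (2^-1 - m.+1%:R / 4) ^+ 2 = Num.sqrt l%:R / l%:R ^+ q.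
  rewrite -powR_mulrn ?powR_ge0 // -powRrM -powR12_sqrt ?ler0n //.
  rewrite -powR_mulrn ?ler0n // -powRB; last by rewrite (gt_eqF l0) implybT.
  by congr powR; rewrite pE; field.
have nE : powR (n%:R : R) (m.+1%:R / 4) ^+ 2 = n%:R ^+ q * Num.sqrt n%:R.
  rewrite -powR_mulrn ?powR_ge0 // -powRrM -powR12_sqrt ?ler0n //.
  rewrite -powR_mulrn ?ler0n // -powRD; last by rewrite (gt_eqF n0) implybT.
  by congr powR; rewrite pE; field.
have yE : powR (ln (n%:R : R)) (4^-1) ^+ 2 = Num.sqrt (ln n%:R).
  rewrite -powR_mulrn ?powR_ge0 // -powRrM -powR12_sqrt //.
  by congr powR; field.
rewrite lE nE yE !sqrtrM ?ler0n //; field.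
by rewrite !expf_neq0 // gt_eqF.
Qed.

Lemma threshold_gt0 : 0 < threshold.
Proof.
have n0 : 0 < n%:R :> R by rewrite ltr0n; nia.
have l0 : 0 < l%:R :> R by rewrite ltr0n; lia.
have y0 : 0 < ln (n%:R : R) by apply: lt_le_trans ln_n_ge1.
rewrite /threshold exprn_gt0 // divr_gt0 ?powR_gt0 // !mulr_gt0 ?powR_gt0 ?exprn_gt0 //.
Qed.

Lemma exists_rate (k : nat) : (0 < k)%N -> (k + k)%:R <= 4 * (l%:R * ln (n%:R : R)) ->
  2 * (k + k)%:R <= n%:R :> R ->
  exists2 z : R, 0 < z & expR 1 * ((link_floor n q l)%:R^-1 *
    ((2 * (l * n) ^ m)%:R * (z ^+ 2 * ((k + k).*2 + n.*2)%:R) +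
     (2 * (m ^ q * (l * n) ^ q))%:R * (k + k).*2%:R *+ 2 +
     (2 * m ^ m)%:R * (k + k).*2%:R / z ^+ 2)) <= threshold.
Proof.
move=> k0 Khi Kn.
have n0 : 0 < n%:R :> R by rewrite ltr0n; nia.
have l0 : 0 < l%:R :> R by rewrite ltr0n; lia.
have m0 : 0 < m%:R :> R by rewrite ltr0n; lia.
have y0 : 0 < ln (n%:R : R) by apply: lt_le_trans ln_n_ge1.
have K0 : 0 < (k + k)%:R :> R by rewrite ltr0n; lia.
set K := (k + k)%:R in Khi Kn K0.
pose L : R := (l * n)%:R ^+ q; pose kap : R := m%:R ^+ q.
pose s : R := Num.sqrt (K / n%:R).
have L0 : 0 < L by rewrite exprn_gt0 // natrM mulr_gt0.
have kap0 : 0 < kap by rewrite exprn_gt0.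
have s0 : 0 < s by rewrite sqrtr_gt0 divr_gt0.
have s2 : s ^+ 2 = K / n%:R by rewrite sqr_sqrtr // divr_ge0 // ltW.
have w0 : 0 < kap * s / L by rewrite divr_gt0 // mulr_gt0.
exists (Num.sqrt (kap * s / L)); first by rewrite sqrtr_gt0.
rewrite sqr_sqrtr; last exact: ltW.
set g := Num.sqrt (n%:R * (l%:R * ln n%:R)) : R.
(* [s * n] is the square root of [n * K], and [K <= 4 l log n]. *)
have sn_le : s * n%:R <= 2 * g.
  rewrite -(@ler_pXn2r _ 2) ?nnegrE ?mulr_ge0 ?sqrtr_ge0 ?ler0n //.
  rewrite !exprMn s2 sqr_sqrtr; last by rewrite !mulr_ge0 ?ler0n // ltW.
  rewrite [leLHS](_ : _ = n%:R * K); last by field; rewrite gt_eqF.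
  by rewrite [leRHS](_ : _ = n%:R * (4 * (l%:R * ln n%:R))) ?ler_wpM2l ?ler0n //; ring.
have poly_le : (2 * (l * n) ^ m)%:R * (kap * s / L * ((k + k).*2 + n.*2)%:R) +
     (2 * (m ^ q * (l * n) ^ q))%:R * (k + k).*2%:R *+ 2 +
     (2 * m ^ m)%:R * (k + k).*2%:R / (kap * s / L) <= 18 * (kap * L) * (s * n%:R).
  rewrite [leLHS](_ : _ =
   2 * L ^+ 2 * (kap * s / L * (2 * K + 2 * n%:R)) + 2 * (2 * (kap * L) * (2 * K)) +
    2 * kap ^+ 2 * (2 * K) / (kap * s / L)); last first.
    have D2 (a : nat) : a.*2%:R = 2 * a%:R :> R by rewrite -mul2n natrM.
    have E1 : (2 * (l * n) ^ m)%:R = 2 * L ^+ 2 :> R.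
      by rewrite (natrM _ 2) natrX exprD -/L expr2.
    have E2 : (2 * (m ^ q * (l * n) ^ q))%:R = 2 * (kap * L) :> R.
      by rewrite 2!natrM !natrX.
    have E3 : (2 * m ^ m)%:R = 2 * kap ^+ 2 :> R by rewrite natrM natrX exprD -/kap expr2.
    by rewrite E1 E2 E3 [(_ + n.*2)%:R]natrD !D2 -/K; ring.
  apply: rate_bound => //.
    by rewrite s2 mulfVK // gt_eqF.
  by rewrite s2 mulrA ler_pdivrMr // mul1r.
have fl0 : 0 < (link_floor n q l)%:R :> R by rewrite ltr0n link_floor_gt0.
have lmn0 : 0 < (l%:R / m%:R) ^+ m * n%:R ^+ (l - m) / 2 :> R.
  by rewrite divr_gt0 // mulr_gt0 // exprn_gt0 // divr_gt0.
have fl_le : (link_floor n q l)%:R^-1 <= ((l%:R / m%:R) ^+ m * n%:R ^+ (l - m) / 2)^-1 :> R.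
  by rewrite lef_pV2 ?posrE //; exact: link_count_lower.
apply: (@le_trans _ _ (4 * (((l%:R / m%:R) ^+ m * n%:R ^+ (l - m) / 2)^-1 *
    (18 * (kap * L) * (2 * g))))).
  apply: ler_pM; [exact: expR_ge0| |exact: expR1_le4|].
    rewrite mulr_ge0 ?invr_ge0 ?ler0n //.
    exact: rate_ge0 (ltW w0).
  apply: ler_pM => //.
    exact: rate_ge0 (ltW w0).
  apply: le_trans poly_le _; rewrite ler_wpM2l //.
  by rewrite !mulr_ge0 // ltW.
rewrite thresholdE -/g.
rewrite [leLHS](_ : _ = (288 * m ^ (3 * q))%:R *
   (n%:R ^+ q * g / (l%:R ^+ q * n%:R ^+ (l - m)))); last first.
  have -> : (3 * q = q + m)%N by rewrite !mulSn addn0.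
  rewrite (natrM _ 288) natrX /kap /L (natrM _ l n) !exprMn !exprVn !exprD.
  move: (gt_eqF m0) (gt_eqF l0) (gt_eqF n0).
  move: (m%:R : R) (l%:R : R) (n%:R : R) => xm xl xn xm0 xl0 xn0.
  field.
  by rewrite !expf_neq0 ?xm0 ?xl0 ?xn0.
rewrite [leRHS](_ : _ = (64 * (m.+1 ^ m.+1) ^ 2)%:R *
   (n%:R ^+ q * g / (l%:R ^+ q * n%:R ^+ (l - m)))); last first.
  by rewrite natrM !natrX; ring.
rewrite ler_wpM2r ?ler_nat ?constants_le //.
by rewrite mulr_ge0 ?invr_ge0 ?mulr_ge0 ?exprn_ge0 ?sqrtr_ge0 ?ler0n.
Qed.

Hypothesis lln : (l%:R <= n%:R / (8 * ln (n%:R : R))).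

Lemma exists_moment_order : exists k : nat,
  [/\ (0 < k)%N, (n%:R ^+ l) ^+ 2 <= expR 1 ^+ (k + k) :> R,
      (k + k)%:R <= 4 * (l%:R * ln (n%:R : R)) & 2 * (k + k)%:R <= n%:R :> R].
Proof.
have ln1 := ln_n_ge1; set y := ln _ in ln1 *.
have n0 : 0 < n%:R :> R by rewrite ltr0n; nia.
have l1 : 2 <= l%:R :> R by rewrite ler_nat; lia.
have x1 : 1 <= l%:R * y by nra.
have ly8 : 8 * (l%:R * y) <= n%:R.
  by move: lln; rewrite -/y ler_pdivlMr; [lra|nra].
(* Rounding up strictly gives [k > l log n], hence [e ^ (2 k) >= n ^ (2 l)]. As [l log n >= 1], also
   [k <= 2 l log n], and [8 l log n <= n] then gives [4 k <= n]. *)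
exists (Num.trunc (l%:R * y)).+1.
set k := (Num.trunc _).+1.
have klo : l%:R * y < k%:R by exact: truncnS_gt.
have khi : k%:R <= l%:R * y + 1.
  by rewrite /k -natr1 lerD2r truncn_le; lra.
split=> //.
- rewrite -exprM -[X in X ^+ _ <= _](lnK (x := n%:R)) ?posrE // -/y.
  rewrite -!expRM_natl ler_expR mulr1 natrM natrD; lra.
- by rewrite natrD; lra.
- by rewrite natrD; lra.
Qed.

End Constants.

Theorem theorem7 (R : realType) (n q l : nat) :
  (1 <= q)%N ->
  (q + q <= l)%N ->
  (l + (q + q) <= n)%N ->
  (l%:R <= n%:R / (4 * (q + q)%:R) :> R) ->
  (l%:R <= n%:R / (8 * ln (n%:R : R))) ->
  (forall Y : idx n q -> R, (forall i, Y i = 1 \/ Y i = -1) ->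
     inj_norm Y <= Num.sqrt (n%:R) +
       powR (n%:R) (l%:R / 2 - q%:R) * Num.sqrt (opnorm (@Mmat R n q l Y)))
  /\
  rad_prob (fun Y : idx n q -> R =>
     Num.sqrt (n%:R) + powR (n%:R) (l%:R / 2 - q%:R) * Num.sqrt (opnorm (@Mmat R n q l Y))
     <= Num.sqrt (n%:R) + 8 * ((q + q).+1%:R) ^+ (q + q).+1
          * powR (l%:R) (2^-1 - ((q + q).+1)%:R / 4)
          * powR (n%:R) (((q + q).+1)%:R / 4)
          * powR (ln (n%:R)) (4^-1))
  >= 1 - ((n%:R) ^+ l)^-1.
Proof.
move=> q0 ml _ ln4R lln.
have m0 : 0 < (q + q)%:R :> R by rewrite ltr0n; lia.
have ln4 : (4 * (q + q) * l <= n)%N.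
  move: ln4R; rewrite ler_pdivlMr; last by rewrite mulr_gt0.
  by rewrite -!natrM ler_nat mulnC.
have n0 : (0 < n)%N by nia.
have N0 a b c d : (link_floor n q l <= @Ncount n q l a b c d)%N by exact: Ncount_ge.
have fl0 := link_floor_gt0 q0 ml ln4.
split=> [Y Y1|].
  by apply: inj_norm_le => // a b c d; exact: leq_trans fl0 (N0 _ _ _ _).
have [k [k0 n_e Khi Kn]] := exists_moment_order q0 ml ln4 lln.
have [z z0 rate_le] := exists_rate q0 ml ln4 k0 Khi Kn.
have tr_le := trace_moment_le (k + k) z0 fl0 N0.
have w0 : 0 <= (z ^+ 2) :> R by rewrite exprn_ge0 // ltW.
apply: (rad_prob_opnorm_ge n0 k0 (threshold_gt0 q0 ml ln4) _ rate_le n_e tr_le) => [|s op_le].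
  by rewrite mulr_ge0 ?invr_ge0 ?ler0n ?rate_ge0.
rewrite lerD2l; set B := 8 * _ * _ * _ * _.
have P0 : 0 < powR (n%:R : R) (l%:R / 2 - q%:R) by rewrite powR_gt0 // ltr0n.
have B0 : 0 <= B by rewrite !mulr_ge0 ?powR_ge0 ?exprn_ge0.
(* Dividing by the power of [n] turns the event into a comparison of square roots, that of the norm
   and that of [threshold]. *)
rewrite mulrC -ler_pdivlMr //.
have -> : B / powR (n%:R) (l%:R / 2 - q%:R) = Num.sqrt (@threshold R n q l).
  by rewrite /threshold sqrtr_sqr ger0_norm // divr_ge0 // ltW.
by rewrite ler_sqrt // ltW // threshold_gt0.
Qed.
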